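(* Let $0\le s<r<1$ and $\lambda\in\mathbb{C}$ with $|\lambda|<1$. With $V(r,s,\lambda)$, $A,B,C,\eta,t,c(\cdot),\zeta_\theta$ as defined in the context, the following hold. (i) If $t+|\eta|\le\frac12$, then $\partial V(r,s,\lambda)$ coincides with the Jordan curve given by $$\partial\mathbb{D}\ni\zeta\mapsto A\big(B+C\,c(\zeta)\big).$$ (ii) If $t-|\eta|\ge\frac12$, then $\partial V(r,s,\lambda)$ coincides with the circle given by $$\partial\mathbb{D}\ni\zeta\mapsto A\left\{B+\frac{[1+4(t^2-|\eta|^2)]\,t\,\zeta-\overline{\eta}}{4(t^2-|\eta|^2)}\,C\right\}.$$ (iii) If $t+|\eta|>\frac12$ and $t-|\eta|<\frac12$, then $\partial V(r,s,\lambda)$ consists of the circular arc given by $$\Theta\ni\theta\mapsto A\left\{B+\frac{[1+4(t^2-|\eta|^2)]\,t\,e^{i\theta}-\overline{\eta}}{4(t^2-|\eta|^2)}\,C\right\}$$ and the simple arc given by $$J\ni\zeta\mapsto A\big(B+C\,c(\zeta)\big),$$ where $$\Theta=\left\{\theta\in(-\pi,\pi]:\cos(\theta+\arg\eta)>\frac{t^2+|\eta|^2-4(t^2-|\eta|^2)^2}{2t|\eta|}\right\}$$ and $$J=\left\{\zeta_\theta:\ \theta\in(-\pi,\pi],\ \cos(\theta+\arg\eta)\le\frac{t^2+|\eta|^2-4(t^2-|\eta|^2)^2}{2t|\eta|}\right\}$$ is a closed subarc of $\partial\mathbb{D}$.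
   Context: $\mathbb{D}=\{z\in\mathbb{C}:|z|<1\}$ is the open unit disk; $\mathcal{H}_0$ is the set of all analytic maps $f:\mathbb{D}\to\mathbb{D}$ with $f(0)=0$. For $0\le s<r<1$ and $\lambda\in\mathbb{D}$: $$\mathcal{H}_0(r,s,\lambda)=\Big\{f\in\mathcal{H}_0: f(r)=s,\ f'(r)=\frac{s}{r}+\frac{r^2-s^2}{r(1-r^2)}\lambda\Big\},\qquad V(r,s,\lambda)=\{f'''(r): f\in\mathcal{H}_0(r,s,\lambda)\}\subset\mathbb{C}.$$ Constants: $$A=\frac{6(r^2-s^2)}{r^3(1-r^2)^3},\quad B=s^2\lambda^3-s(1+r^2)\lambda^2+r^2\lambda,\quad C=r(1-|\lambda|^2)(1+r^2-2s\lambda),$$ $$\eta=\frac{r\overline{\lambda}}{1+r^2-2s\lambda},\qquad t=\frac{r}{|1+r^2-2s\lambda|}.$$ The function $c$ is $c(\zeta)=\zeta(1-\eta\zeta)$ for $\zeta\in\overline{\mathbb{D}}$. For $\theta\in\mathbb{R}$: if $|te^{i\theta}-\overline{\eta}|\ge 2(t^2-|\eta|^2)$, let $t_\theta$ be the unique solution $x$ of $|xe^{i\theta}-\overline{\eta}|=2(x^2-|\eta|^2)$, $x>|\eta|$; otherwise let $t_\theta=t$. Set $$\zeta_\theta=\frac{t_\theta e^{i\theta}-\overline{\eta}}{2(t_\theta^2-|\eta|^2)}\in\overline{\mathbb{D}}.$$ *)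

(* Defs.v *)
From HB Require Import structures.
From mathcomp Require Import all_boot all_order all_algebra.
From mathcomp Require Import all_classical all_reals all_analysis.
From mathcomp.real_closed Require Import complex.
Import Order.TTheory GRing.Theory Num.Theory.
Import numFieldNormedType.Exports.

Set Implicit Arguments.
Unset Strict Implicit.
Unset Printing Implicit Defensive.

Local Open Scope classical_set_scope.
Local Open Scope ring_scope.
Local Open Scope complex_scope.

(* The carrier of R[i] displayed as that of a numFieldType: this is the form on
   which the topology and the normed module structure of the complex plane are
   inferred. *)
Notation CC R := (Num.NumField.sort (complex R : numFieldType)).

Definition unit_disk {R : realType} : set (CC R) := [set z | `|z| < 1].

Definition unit_circle {R : realType} : set (CC R) := [set z | `|z| = 1].

Definition frontier {T : topologicalType} (X : set T) : set T :=
  closure X `\` interior X.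

(* The modulus as a real number; on R[i], `|z| is again an element of R[i]. *)
Definition cmod {R : realType} (z : CC R) : R := complex.Re `|z|.

Definition expi {R : realType} (theta : R) : CC R := cos theta +i* sin theta.

(* Principal argument, in ]-pi, pi] for z != 0; junk value at z = 0. *)
Definition Arg {R : realType} (z : CC R) : R :=
  let a := acos (complex.Re z / cmod z) in
  if 0 <= complex.Im z then a else - a.

Definition analytic_on {R : realType} (D : set (CC R)) (f : CC R -> CC R) : Prop :=
  forall z0, D z0 -> exists a : nat -> CC R,
    \forall z \near z0, [series a k * (z - z0) ^+ k]_k @ \oo --> f z.

(* Functions are total on CC R; only their values on the unit disk matter. *)
Definition H0 {R : realType} : set (CC R -> CC R) :=
  [set f | [/\ analytic_on unit_disk f,
               (forall z, unit_disk z -> unit_disk (f z)) & f 0 = 0]].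

Definition H0_at {R : realType} (r s : R) (lam : CC R) : set (CC R -> CC R) :=
  [set f | [/\ H0 f,
               f r%:C = s%:C &
               (f^`())%classic r%:C =
                 (s / r)%:C + ((r ^+ 2 - s ^+ 2) / (r * (1 - r ^+ 2)))%:C * lam]].

Definition Vset {R : realType} (r s : R) (lam : CC R) : set (CC R) :=
  [set (f^`(3))%classic r%:C | f in H0_at r s lam].

Definition coefA {R : realType} (r s : R) : R :=
  6 * (r ^+ 2 - s ^+ 2) / (r ^+ 3 * (1 - r ^+ 2) ^+ 3).

Definition coefB {R : realType} (r s : R) (lam : CC R) : CC R :=
  (s ^+ 2)%:C * lam ^+ 3 - (s * (1 + r ^+ 2))%:C * lam ^+ 2 + (r ^+ 2)%:C * lam.

Definition coefC {R : realType} (r s : R) (lam : CC R) : CC R :=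
  r%:C * (1 - `|lam| ^+ 2) * (1 + r%:C ^+ 2 - 2 * s%:C * lam).

Definition eta {R : realType} (r s : R) (lam : CC R) : CC R :=
  r%:C * lam^* / (1 + r%:C ^+ 2 - 2 * s%:C * lam).

Definition tpar {R : realType} (r s : R) (lam : CC R) : R :=
  r / cmod (1 + r%:C ^+ 2 - 2 * s%:C * lam).

Definition cfun {R : realType} (r s : R) (lam zeta : CC R) : CC R :=
  zeta * (1 - eta r s lam * zeta).

(* [xget t X] picks an element of X, the singleton of the unique solution when
   the test succeeds. *)
Definition ttheta {R : realType} (r s : R) (lam : CC R) (theta : R) : R :=
  let e := eta r s lam in
  let t := tpar r s lam in
  if 2 * (t ^+ 2 - cmod e ^+ 2) <= cmod (t%:C * expi theta - e^*) then
    xget t [set x | cmod e < x /\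
                    cmod (x%:C * expi theta - e^*) = 2 * (x ^+ 2 - cmod e ^+ 2)]
  else t.

Definition zetatheta {R : realType} (r s : R) (lam : CC R) (theta : R) : CC R :=
  let e := eta r s lam in
  let x := ttheta r s lam theta in
  (x%:C * expi theta - e^*) / (2 * (x ^+ 2 - cmod e ^+ 2))%:C.

Definition curve {R : realType} (r s : R) (lam zeta : CC R) : CC R :=
  (coefA r s)%:C * (coefB r s lam + coefC r s lam * cfun r s lam zeta).

Definition circ {R : realType} (r s : R) (lam zeta : CC R) : CC R :=
  let e := eta r s lam in
  let t := tpar r s lam in
  let d := 4 * (t ^+ 2 - cmod e ^+ 2) in
  (coefA r s)%:C *
    (coefB r s lam + (((1 + d) * t)%:C * zeta - e^*) / d%:C * coefC r s lam).

Definition cosbound {R : realType} (r s : R) (lam : CC R) : R :=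
  let m := cmod (eta r s lam) in
  let t := tpar r s lam in
  (t ^+ 2 + m ^+ 2 - 4 * (t ^+ 2 - m ^+ 2) ^+ 2) / (2 * t * m).

Definition Theta {R : realType} (r s : R) (lam : CC R) : set R :=
  [set theta | theta \in `]- pi, pi] /\
               cosbound r s lam < cos (theta + Arg (eta r s lam))].

Definition Jset {R : realType} (r s : R) (lam : CC R) : set (CC R) :=
  [set zetatheta r s lam theta | theta in
     [set theta | theta \in `]- pi, pi] /\
                  cos (theta + Arg (eta r s lam)) <= cosbound r s lam]].

(* With X the unit circle, [g @` X] is a Jordan curve parametrized by g; with X
   a closed arc of the unit circle, [g @` X] is a simple arc. *)
Definition simple_param {R : realType} (X : set (CC R)) (g : CC R -> CC R) : Prop :=
  {within X, continuous g} /\ set_inj X g.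

Definition is_circle {R : realType} (X : set (CC R)) : Prop :=
  exists (z0 : CC R) (rho : R), 0 < rho /\ X = [set z | `|z - z0| = rho%:C].

Definition is_circular_arc {R : realType} (X : set (CC R)) : Prop :=
  exists (z0 : CC R) (rho a b : R), [/\ 0 < rho, a < b < a + 2 * pi &
    X = [set z0 + rho%:C * expi u | u in [set u | u \in `]a, b[]]].

Definition is_closed_subarc {R : realType} (X : set (CC R)) : Prop :=
  exists a b : R, a < b < a + 2 * pi /\
    X = [set expi u | u in [set u | u \in `[a, b]]].

(* Main.v *)
Require Import Defs.
From mathcomp Require Import all_boot all_order all_algebra.
From mathcomp Require Import all_classical all_reals all_analysis.
From mathcomp.real_closed Require Import complex.
From mathcomp Require Import ring lra.
Import Order.TTheory GRing.Theory Num.Theory.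
Import numFieldNormedType.Exports.

(** Write f(z) = z g(z) and run two steps of Schur's algorithm at the point r,
    g -> g1 -> g2: each step moves the value at r to 0 by a disk automorphism and
    divides by the Blaschke factor of r.  The conditions on f(r) and f'(r) say
    that g(r) = s/r and g1(r) = lam.  Expanding at r gives, with zeta = g2(r),
      f'''(r) = A (B + C (c(zeta) + tau (1 - r^2) g2'(r))),   |tau| = t
    ([H0_at_coef]).  By the Schwarz-Pick inequality the last term ranges over the
    disk of radius t (1 - |zeta|^2), and running the algorithm backwards from
    constants produces rational functions that realize every such value
    ([Vset_disk_union]).  So V is the image under w |-> A (B + C w) of the union W of
    the disks of center c(zeta) and radius t (1 - |zeta|^2), |zeta| <= 1.

    Since |eta| < t, the set W is compact and convex, and its boundary consists of
    its support points.  The support point in the direction u = e^(i theta)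
    maximizes Re (conj u c(z)) + t (1 - |z|^2), a strictly concave function of z.
    If its critical point lies in the open unit disk, the support point is on the
    disk above it, and these points describe a circle as u varies
    ([extremal_circle]).  Otherwise the maximum is at a point of the unit circle
    where the gradient condition holds with a Lagrange multiplier t_theta >= t in
    place of t: this is zeta_theta, and the support point is c(zeta_theta)
    ([frontier_disk_union]).  The three cases of the theorem are those where the
    second alternative holds for all theta, for none up to equality, or for a
    proper arc of directions; in the last case both arcs are cut out by a bound
    on a cosine ([closed_arc], [open_arc]).

    The function theory rests on functions that have Taylor expansions of every
    order at every point.  For them |f|^2 + eps |z|^2 has no local maximum,
    because its mean over four symmetric points exceeds its value at the center;
    this yields the maximum principle, hence Cauchy's estimate, termwise
    differentiation of the expansions and the Schwarz lemma, without integration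
    and without global power series. *)

Set Implicit Arguments.
Unset Strict Implicit.
Unset Printing Implicit Defensive.

Local Open Scope classical_set_scope.
Local Open Scope ring_scope.
Local Open Scope complex_scope.

(* [ring_scope] and [complex_scope] have two convertible conjugations under the
   same notation; a single one keeps rewriting predictable. *)
Local Notation "z ^*" := (Num.conj z) : complex_scope.

(** * The modulus as a real number *)

Section Modulus.
Variable R : realType.
Implicit Types z w : CC R.

Lemma cmodE z : (cmod z)%:C = `|z|.
Proof. by rewrite /cmod RRe_real // ger0_real // normr_ge0. Qed.

Lemma cmod_ge0 z : 0 <= cmod z.
Proof. by rewrite -ler0c cmodE normr_ge0. Qed.

Lemma cmodM z w : cmod (z * w) = cmod z * cmod w.
Proof. by apply: complexI; rewrite rmorphM /= !cmodE normrM. Qed.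

Lemma cmodD z w : cmod (z + w) <= cmod z + cmod w.
Proof. by rewrite -lecR rmorphD /= !cmodE ler_normD. Qed.

Lemma cmodN z : cmod (- z) = cmod z.
Proof. by apply: complexI; rewrite !cmodE normrN. Qed.

Lemma cmodV z : cmod z^-1 = (cmod z)^-1.
Proof. by apply: complexI; rewrite fmorphV /= !cmodE normfV. Qed.

Lemma cmodX z n : cmod (z ^+ n) = cmod z ^+ n.
Proof. by apply: complexI; rewrite rmorphXn /= !cmodE normrX. Qed.

Lemma conjE z : z^* = conjc z.
Proof. by []. Qed.

Lemma cmodJ z : cmod (z^*) = cmod z.
Proof. by apply: complexI; rewrite !cmodE norm_conjC. Qed.

Lemma cmod_real (x : R) : 0 <= x -> cmod (x%:C) = x.
Proof. by move=> x0; apply: complexI; rewrite !cmodE ger0_norm // ler0c. Qed.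

Lemma cmod0 : cmod (0 : CC R) = 0.
Proof. exact: cmod_real. Qed.

Lemma cmod1 : cmod (1 : CC R) = 1.
Proof. by apply: cmod_real. Qed.

Lemma cmod_eq0 z : (cmod z == 0) = (z == 0).
Proof. by rewrite -(inj_eq (@complexI R)) cmodE normr_eq0. Qed.

Lemma cmod_gt0 z : (0 < cmod z) = (z != 0).
Proof. by rewrite lt_def cmod_ge0 andbT cmod_eq0. Qed.

Lemma cmodB z w : cmod (z - w) <= cmod z + cmod w.
Proof. by rewrite (le_trans (cmodD _ _)) // cmodN. Qed.

Lemma cmodBC z w : cmod (z - w) = cmod (w - z).
Proof. by rewrite -cmodN opprB. Qed.

Lemma cmod_sqr z : cmod z ^+ 2 = complex.Re z ^+ 2 + complex.Im z ^+ 2.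
Proof. by apply: complexI; rewrite rmorphXn /= cmodE -add_Re2_Im2. Qed.

Lemma cmod_sqrC z : (cmod z ^+ 2)%:C = z * z^*.
Proof. by rewrite rmorphXn /= cmodE normCK. Qed.

Lemma Re_le_cmod z : complex.Re z <= cmod z.
Proof.
have [z0|z0] := leP (complex.Re z) 0; first exact: le_trans z0 (cmod_ge0 _).
rewrite -ler_sqr ?nnegrE ?cmod_ge0 ?(ltW z0) // cmod_sqr.
by rewrite lerDl sqr_ge0.
Qed.

Lemma conj_realC (x : R) : (x%:C)^* = x%:C.
Proof. exact: conjc_real. Qed.

Lemma nbhs_cmod z (P : set (CC R)) :
  nbhs z P <-> exists2 d : R, 0 < d & forall w, cmod (w - z) < d -> P w.
Proof.
split.
  move=> /nbhs_normP[e /= e0 he].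
  have er : e = (complex.Re e)%:C by rewrite RRe_real // gtr0_real.
  exists (complex.Re e); first by rewrite -ltcR -er.
  by move=> w hw; apply: he; rewrite /ball_ /= distrC er -cmodE ltcR.
move=> [d d0 hd]; apply/nbhs_normP; exists d%:C => /=; first by rewrite ltcR.
by move=> w; rewrite /ball_ /= distrC -cmodE ltcR => /hd.
Qed.

End Modulus.

(** * Taylor expansions *)

Section Taylor.
Variable R : realType.
Local Notation C := (CC R).
Implicit Types (z h : C) (e f g : C -> C) (p q : {poly C}).

Definition near0 (P : C -> Prop) :=
  exists2 d : R, 0 < d & forall h, cmod h < d -> P h.

Lemma near0W (P Q : C -> Prop) : (forall h, P h -> Q h) -> near0 P -> near0 Q.
Proof. by move=> PQ [d d0 hd]; exists d => // h /hd/PQ. Qed.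

Lemma near0I (P Q : C -> Prop) :
  near0 P -> near0 Q -> near0 (fun h => P h /\ Q h).
Proof.
move=> [d d0 hd] [d' d'0 hd']; exists (Num.min d d'); first by rewrite lt_min d0.
by move=> h; rewrite lt_min => /andP[/hd ? /hd' ?].
Qed.

Lemma near0_lt (d : R) : 0 < d -> near0 (fun h => cmod h < d).
Proof. by move=> d0; exists d. Qed.

Lemma near0_nbhs z (P : set C) : nbhs z P <-> near0 (fun h => P (z + h)).
Proof.
rewrite nbhs_cmod; split=> -[d d0 hd]; exists d => //.
  by move=> h hh; apply: hd; rewrite addrC addKr.
by move=> w hw; have := hd _ hw; rewrite addrC subrK.
Qed.

Lemma near0_at0 (P : C -> Prop) : near0 P -> P 0.
Proof. by move=> [d d0]; apply; rewrite cmod0. Qed.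

(** The bound is also required at h = 0, so for n > 0 it forces e 0 = 0. *)
Definition bigO (n : nat) e :=
  exists K : R, near0 (fun h => cmod (e h) <= K * cmod h ^+ n).

Lemma bigOP n e : bigO n e ->
  exists2 K : R, 0 < K & near0 (fun h => cmod (e h) <= K * cmod h ^+ n).
Proof.
move=> [K hK]; exists (`|K| + 1); first by rewrite ltr_wpDl.
apply: near0W hK => h /le_trans; apply; apply: ler_wpM2r.
  by rewrite exprn_ge0 ?cmod_ge0.
by rewrite (le_trans (ler_norm _)) // lerDl.
Qed.

Lemma bigO_near n e e' : near0 (fun h => e h = e' h) -> bigO n e -> bigO n e'.
Proof.
move=> he [K hK]; exists K; apply: near0W (near0I he hK) => h [<-]; exact.
Qed.

Lemma bigO_eq n e e' : e =1 e' -> bigO n e -> bigO n e'.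
Proof. by move=> he; apply: bigO_near; exists 1. Qed.

Lemma bigO_le m n e : (m <= n)%N -> bigO n e -> bigO m e.
Proof.
move=> mn /bigOP[K K0 hK]; exists K.
apply: near0W (near0I hK (near0_lt ltr01)) => h [/le_trans hh h1].
apply: hh; rewrite ler_pM2l //; apply: ler_wiXn2l mn; first exact: cmod_ge0.
exact: ltW.
Qed.

Lemma bigOD n e e' : bigO n e -> bigO n e' -> bigO n (fun h => e h + e' h).
Proof.
move=> [K hK] [L hL]; exists (K + L); apply: near0W (near0I hK hL) => h [h1 h2].
by rewrite mulrDl (le_trans (cmodD _ _)) // lerD.
Qed.

Lemma bigOM m n e e' :
  bigO m e -> bigO n e' -> bigO (m + n) (fun h => e h * e' h).
Proof.
move=> [K hK] [L hL]; exists (K * L); apply: near0W (near0I hK hL) => h [h1 h2].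
by rewrite cmodM exprD mulrACA ler_pM ?cmod_ge0.
Qed.

Lemma bigON n e : bigO n e -> bigO n (fun h => - e h).
Proof. by move=> [K hK]; exists K; apply: near0W hK => h; rewrite cmodN. Qed.

Lemma bigOMl n e e' : bigO 0 e -> bigO n e' -> bigO n (fun h => e h * e' h).
Proof. exact: (@bigOM 0 n). Qed.

Lemma bigO_cst (c : C) : bigO 0 (fun=> c).
Proof. by exists (cmod c); exists 1 => // h _; rewrite expr0 mulr1. Qed.

Lemma bigO_id : bigO 1 id.
Proof. by exists 1; exists 1 => // h _; rewrite mul1r expr1. Qed.

Lemma bigO_X n : bigO n (fun h => h ^+ n).
Proof. by exists 1; exists 1 => // h _; rewrite mul1r cmodX. Qed.

Lemma bigO_poly p : bigO 0 (fun h => p.[h]).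
Proof.
elim/poly_ind: p => [|p c IH].
  by apply: bigO_eq (bigO_cst 0) => h; rewrite horner0.
apply: bigO_eq (bigOD (bigOMl IH (bigO_le (leq0n 1) bigO_id)) (bigO_cst c)).
by move=> h; rewrite hornerMXaddC.
Qed.


Lemma small_eq0 (c : C) (L d : R) : 0 < d ->
  (forall h, h != 0 -> cmod h < d -> cmod c <= L * cmod h) -> c = 0.
Proof.
move=> d0 hd; apply/eqP; rewrite -cmod_eq0; apply/negPn/negP => c0.
have {}c0 : 0 < cmod c by rewrite lt_def c0 cmod_ge0.
pose M := 2 * (`|L| + 1); have M0 : 0 < M by rewrite mulr_gt0 // ltr_wpDl.
pose x := Num.min (d / 2) (cmod c / M).
have x0 : 0 < x by rewrite lt_min !divr_gt0.
have xd : x < d by rewrite gt_min ltr_pdivrMr // mulr_natr mulr2n ltrDl d0.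
have xc : M * x <= cmod c by rewrite mulrC -ler_pdivlMr // ge_min lexx orbT.
have := hd x%:C; rewrite -cmod_eq0 cmod_real ?(ltW x0) // gt_eqF //.
move=> /(_ isT xd) cL.
have : L * x <= `|L| * x by rewrite ler_pM2r // ler_norm.
by move: xc; rewrite /M; lra.
Qed.

Lemma bigO_poly_coef n p k : bigO n (fun h => p.[h]) -> (k < n)%N -> p`_k = 0.
Proof.
suff H0 q (K d : R) m : 0 < d -> (forall h, h != 0 -> cmod h < d ->
    cmod (q.[h]) <= K * cmod h ^+ m) -> forall k, (k < m)%N -> q`_k = 0.
  by move=> [K [d d0 hd]]; apply: (H0 p K d) => // h _; exact: hd.
elim: m q K d => // m IH q; elim/poly_ind: q => [|q c _] K d d0 hq j jm.
  by rewrite coef0.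
have [L L0 [d' d'0 hL]] := bigOP (bigO_poly q).
have c0 : c = 0.
  apply: (@small_eq0 c (`|K| + L) (Num.min (Num.min d d') 1)).
    by rewrite !lt_min d0 d'0 ltr01.
  move=> h h0; rewrite !lt_min => /andP[/andP[hd hd'] h1].
  have -> : c = (q * 'X + c%:P).[h] - q.[h] * h by rewrite hornerMXaddC; ring.
  apply: (le_trans (cmodB _ _)); rewrite mulrDl; apply: lerD.
    apply: (le_trans (hq _ h0 hd)).
    apply: (@le_trans _ _ (`|K| * cmod h ^+ m.+1)).
      by rewrite ler_wpM2r ?exprn_ge0 ?cmod_ge0 ?ler_norm.
    rewrite ler_wpM2l //; apply: ler_wiXn2l (ltn0Sn m) => //; first exact: cmod_ge0.
    exact: ltW.
  by rewrite cmodM ler_wpM2r ?cmod_ge0 //; have := hL _ hd'; rewrite expr0 mulr1.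
rewrite -cons_poly_def coef_cons; case: j jm => [|j] //; rewrite ltnS => jm /=.
apply: (IH q K d d0) jm => h h0 hd; have := hq h h0 hd.
rewrite c0 addr0 hornerMX cmodM exprSr mulrA ler_pM2r //.
by rewrite cmod_gt0.
Qed.

Lemma bigO_coef0 n p : (forall k, (k < n)%N -> p`_k = 0) -> bigO n (fun h => p.[h]).
Proof.
elim: n p => [|n IH] p hp; first exact: bigO_poly.
elim/poly_ind: p hp => [|p c _] hp.
  apply: bigO_eq (bigO_le (leqnn _) (bigOMl (bigO_cst 0) (bigO_X n.+1))) => h.
  by rewrite mul0r horner0.
have c0 : c = 0 by have := hp 0%N isT; rewrite -cons_poly_def coef_cons.
have /IH hO : forall k, (k < n)%N -> p`_k = 0.
  by move=> k kn; have := hp k.+1 kn; rewrite -cons_poly_def coef_cons.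
rewrite -addn1; apply: bigO_eq (bigOM hO bigO_id) => h.
by rewrite c0 addr0 hornerMX.
Qed.

Definition taylor n f z p := bigO n (fun h => f (z + h) - p.[h]).

Lemma taylor_le m n f z p : (m <= n)%N -> taylor n f z p -> taylor m f z p.
Proof. exact: bigO_le. Qed.

Lemma taylor_near n f g z p :
  near0 (fun h => f (z + h) = g (z + h)) -> taylor n f z p -> taylor n g z p.
Proof. by move=> fg; apply: bigO_near; apply: near0W fg => h ->. Qed.

Lemma taylor_poly n f z p q : (forall k, (k < n)%N -> p`_k = q`_k) ->
  taylor n f z p -> taylor n f z q.
Proof.
move=> pq fp; have pqO : bigO n (fun h => (p - q).[h]).
  by apply: bigO_coef0 => k kn; rewrite coefB pq // subrr.
apply: bigO_eq (bigOD fp pqO) => h; rewrite hornerD hornerN; ring.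
Qed.

Lemma taylor_uniq n f z p q k :
  taylor n f z p -> taylor n f z q -> (k < n)%N -> p`_k = q`_k.
Proof.
move=> fp fq kn; apply/eqP; rewrite -subr_eq0 -coefB; apply/eqP.
apply: bigO_poly_coef kn; apply: bigO_eq (bigOD fq (bigON fp)) => h.
rewrite hornerD hornerN; ring.
Qed.

Lemma taylor_bounded n f z p : taylor n f z p -> bigO 0 (fun h => f (z + h)).
Proof.
move=> fp; apply: bigO_eq (bigOD (bigO_le (leq0n n) fp) (bigO_poly p)) => h.
by rewrite subrK.
Qed.

Lemma taylor_horner n p z : taylor n (horner p) z (p \Po ('X + z%:P)).
Proof.
apply: bigO_eq (bigO_coef0 (p := 0) (n := n) _) => [h|k _]; last by rewrite coef0.
by rewrite horner_comp !hornerE (addrC z) subrr.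
Qed.

Lemma taylorD n f g z p q : taylor n f z p -> taylor n g z q ->
  taylor n (fun w => f w + g w) z (p + q).
Proof.
by move=> fp gq; apply: bigO_eq (bigOD fp gq) => h; rewrite hornerD; ring.
Qed.

Lemma taylorM n f g z p q : taylor n f z p -> taylor n g z q ->
  taylor n (fun w => f w * g w) z (p * q).
Proof.
move=> fp gq; apply: bigO_eq (bigOD (bigOMl (taylor_bounded fp) gq)
  (bigOMl (bigO_poly q) fp)) => h.
by rewrite hornerM; ring.
Qed.

Lemma taylor0 n f z p : taylor n.+1 f z p -> f z = p`_0.
Proof.
move=> [K [d d0 /(_ 0)]]; rewrite cmod0 => /(_ d0).
rewrite expr0n mulr0 addr0 horner_coef0 => h.
apply/eqP; rewrite -subr_eq0 -cmod_eq0 eq_le h; exact: cmod_ge0.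
Qed.

Lemma taylor_near0 n f z p (eps : R) : taylor n.+1 f z p -> 0 < eps ->
  near0 (fun h => cmod (f (z + h) - f z) < eps).
Proof.
move=> fp e0; have: bigO 1 (fun h => f (z + h) - f z).
  have h1 := taylor_le (ltn0Sn n) fp.
  rewrite (taylor0 fp) -horner_coef0.
  apply: bigO_eq (bigOD h1 (bigO_coef0 (p := p - (p.[0])%:P) _)) => [h|k].
    by rewrite hornerD hornerN hornerC; ring.
  by rewrite ltnS leqn0 => /eqP ->; rewrite coefB coefC /= horner_coef0 subrr.
move=> /bigOP[K K0 hK].
apply: near0W (near0I hK (near0_lt (divr_gt0 e0 K0))) => h [/le_lt_trans h1 h2].
by apply: h1; rewrite expr1 mulrC -ltr_pdivlMr.
Qed.


Lemma bigO0_inv n f z p : f z != 0 -> taylor n.+1 f z p ->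
  bigO 0 (fun h => (f (z + h))^-1) /\ near0 (fun h => f (z + h) != 0).
Proof.
move=> fz fp; have fz0 : 0 < cmod (f z) by rewrite cmod_gt0.
have fn : near0 (fun h => cmod (f z) / 2 < cmod (f (z + h))).
  have fz2 : 0 < cmod (f z) / 2 by rewrite divr_gt0.
  apply: near0W (taylor_near0 fp fz2) => h hh.
  have := cmodD (f (z + h)) (f z - f (z + h)).
  by rewrite addrC subrK (cmodBC (f z)); lra.
split; last first.
  by apply: near0W fn => h hh; rewrite -cmod_gt0; apply: lt_trans hh; rewrite divr_gt0.
exists (cmod (f z) / 2)^-1; apply: near0W fn => h hh.
have f2 : 0 < cmod (f z) / 2 by rewrite divr_gt0.
rewrite expr0 mulr1 cmodV lef_pV2 ?posrE ?(ltW hh) //.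
exact: lt_trans hh.
Qed.

(** 1/p modulo X^n is the truncated geometric series in 1 - p / p(0). *)
Lemma taylorV n f z p : f z != 0 -> taylor n.+1 f z p ->
  exists q, taylor n.+1 (fun w => (f w)^-1) z q.
Proof.
move=> fz fp.
have p0 : p`_0 != 0 by rewrite -(taylor0 fp).
pose w := 1 - (p`_0)^-1 *: p.
have [w' ww'] : exists w', w = w' * 'X.
  have : w`_0 = 0 by rewrite coefB coefZ coef1 /= mulVf // subrr.
  elim/poly_ind: w => [|w c _]; first by exists 0; rewrite mul0r.
  by rewrite -cons_poly_def coef_cons /= => ->; exists w; rewrite cons_poly_def addr0.
pose q := (p`_0)^-1 *: \sum_(i < n.+1) w ^+ i; exists q.
have pq : 1 - q * p = w ^+ n.+1.
  have -> : q * p = (1 - w) * \sum_(i < n.+1) w ^+ i.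
    have -> : 1 - w = (p`_0)^-1 *: p by rewrite /w opprB addrCA subrr addr0.
    by rewrite -!scalerAl mulrC.
  have := subrX1 w n.+1; rewrite -[1 - w]opprB mulNr => <-; ring.
have [bV nz] := bigO0_inv fz fp.
have bw : bigO n.+1 (fun h => (1 - q * p).[h]).
  apply: bigO_coef0 => k kn; rewrite pq ww' exprMn coefMXn kn //.
apply: (bigO_near _ (bigOMl bV (bigOD bw (bigON (bigOMl (bigO_poly q) fp))))).
apply: near0W nz => h h0; rewrite hornerD hornerN hornerM hornerC.
by field.
Qed.

(** Taylor expansions of every order at [z]. Demanding all orders makes the notion
    stable under division by a factor h, and it needs no convergence. *)
Definition regular f z := forall n, exists p, taylor n f z p.

(** Any polynomial may be chosen: two Taylor polynomials agree below their order
    ([taylor_uniq]). *)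
Definition tcoef f z k : C := (xget 0 [set p | taylor k.+1 f z p])`_k.

Lemma tcoefE n f z p k : taylor n f z p -> (k < n)%N -> tcoef f z k = p`_k.
Proof.
move=> fp kn; rewrite /tcoef; have fk := taylor_le kn fp.
by case: xgetP => [q -> /= fq|/(_ p)//]; exact: (taylor_uniq fq fk).
Qed.

Lemma tcoef0 f z : regular f z -> tcoef f z 0 = f z.
Proof. by move=> /(_ 1%N) [p fp]; rewrite (tcoefE fp) // (taylor0 fp). Qed.

Lemma tcoefD f g z k : regular f z -> regular g z ->
  tcoef (fun w => f w + g w) z k = tcoef f z k + tcoef g z k.
Proof.
move=> /(_ k.+1)[p fp] /(_ k.+1)[q gq].
by rewrite (tcoefE fp) // (tcoefE gq) // (tcoefE (taylorD fp gq)) // coefD.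
Qed.

Lemma tcoefM f g z k : regular f z -> regular g z ->
  tcoef (fun w => f w * g w) z k =
  \sum_(i < k.+1) tcoef f z i * tcoef g z (k - i).
Proof.
move=> /(_ k.+1)[p fp] /(_ k.+1)[q gq].
rewrite (tcoefE (taylorM fp gq)) // coefM; apply: eq_bigr => i _.
by rewrite (tcoefE fp) // (tcoefE gq) // ltnS leq_subr.
Qed.

Lemma tcoef_horner p z k : tcoef (horner p) z k = (p \Po ('X + z%:P))`_k.
Proof. exact: (tcoefE (taylor_horner k.+1 p z)). Qed.

Lemma regular_near f g z : near0 (fun h => f (z + h) = g (z + h)) ->
  regular f z -> regular g z.
Proof. by move=> fg rf n; have [p fp] := rf n; exists p; apply: taylor_near fp. Qed.

Lemma regular_horner p z : regular (horner p) z.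
Proof. by move=> n; exists (p \Po ('X + z%:P)); exact: taylor_horner. Qed.

Lemma regular_ext f g z : f =1 g -> regular f z -> regular g z.
Proof. by move=> /funext ->. Qed.

Lemma regular_cst c z : regular (fun=> c) z.
Proof. by apply: (regular_ext _ (regular_horner c%:P z)) => w; rewrite hornerC. Qed.

Lemma regular_id z : regular id z.
Proof. by apply: (regular_ext _ (regular_horner 'X z)) => w; rewrite hornerX. Qed.

Lemma regularD f g z : regular f z -> regular g z -> regular (fun w => f w + g w) z.
Proof.
move=> rf rg n; have [[p fp] [q gq]] := (rf n, rg n).
by exists (p + q); exact: taylorD.
Qed.

Lemma regularM f g z : regular f z -> regular g z -> regular (fun w => f w * g w) z.
Proof.
move=> rf rg n; have [[p fp] [q gq]] := (rf n, rg n).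
by exists (p * q); exact: taylorM.
Qed.

Lemma regularN f z : regular f z -> regular (fun w => - f w) z.
Proof.
move=> rf; apply: regular_ext (regularM (regular_cst (-1) z) rf) => w.
by rewrite mulN1r.
Qed.

Lemma regularB f g z : regular f z -> regular g z -> regular (fun w => f w - g w) z.
Proof. by move=> rf rg; apply: regularD => //; exact: regularN. Qed.

Lemma regularV f z : f z != 0 -> regular f z -> regular (fun w => (f w)^-1) z.
Proof.
move=> fz rf n; have [p fp] := rf n.+1; have [q fq] := taylorV fz fp.
by exists q; exact: taylor_le fq.
Qed.

Lemma regular_cont f z (eps : R) : regular f z -> 0 < eps ->
  near0 (fun h => cmod (f (z + h) - f z) < eps).
Proof. by move=> /(_ 1%N)[p /taylor_near0]; apply. Qed.

(** Removable singularities: dividing out a zero of [f] loses one order of the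
    Taylor expansion, so regularity survives because it asks for all orders. *)
Lemma regular_div f g z : regular f z ->
  near0 (fun h => h * g (z + h) = f (z + h)) -> g z = tcoef f z 1 ->
  regular g z.
Proof.
move=> rf fg gz n; have [p fp] := rf n.+2.
have f0 : f z = 0 by have := near0_at0 fg; rewrite mul0r addr0.
have {}f0 : p`_0 = 0 by rewrite -(taylor0 fp).
have {}gz : g z = p`_1 by rewrite gz (tcoefE fp).
have [q pq] : exists q, p = q * 'X.
  move: f0; elim/poly_ind: (p) => [|q c _]; first by exists 0; rewrite mul0r.
  by rewrite -cons_poly_def coef_cons /= => ->; exists q; rewrite cons_poly_def addr0.
exists q; apply: (bigO_le (leqnSn n)).
have [K fK] := fp; exists K; apply: near0W (near0I fg fK) => h [<-].
have [-> _|h0] := eqVneq h 0.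
  by rewrite addr0 gz pq coefMX /= horner_coef0 subrr cmod0 expr0n mulr0.
rewrite pq hornerMX mulrC -mulrBl cmodM exprSr mulrA ler_pM2r //.
by rewrite cmod_gt0.
Qed.

End Taylor.

(** * Polar coordinates and compact disks *)

Section Polar.
Variable R : realType.
Local Notation C := (CC R).
Implicit Types (z w : C).

Lemma cmod_expi (x : R) : cmod (expi x) = 1.
Proof.
apply/eqP; rewrite -(@eqrXn2 _ 2) ?cmod_ge0 // expr1n cmod_sqr /=.
by rewrite cos2Dsin2.
Qed.

Lemma expiD (x y : R) : expi (x + y) = expi x * expi y.
Proof. by rewrite /expi cosD sinD; simpc; congr (_ +i* _); ring. Qed.

Lemma Arg_bounds z : z != 0 -> - pi < Arg z <= pi /\ z = (cmod z)%:C * expi (Arg z).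
Proof.
move=> z0; have c0 : 0 < cmod z by rewrite cmod_gt0.
have zz := cmod_sqr z.
set a := complex.Re z in zz *; set b := complex.Im z in zz *.
have zE : z = a +i* b by rewrite /a /b; case: (z).
have x2 : (a / cmod z) ^+ 2 + (b / cmod z) ^+ 2 = 1.
  by rewrite !expr_div_n -mulrDl -zz divff // expf_neq0 // gt_eqF.
have x1 : -1 <= a / cmod z <= 1.
  rewrite -ler_norml -(@ler_sqr _ _ 1) ?nnegrE // real_normK ?num_real //.
  by rewrite expr1n -x2 lerDl sqr_ge0.
have sE : sin (acos (a / cmod z)) = `|b| / cmod z.
  rewrite sin_acos // (_ : 1 - _ = (b / cmod z) ^+ 2); last by rewrite -x2; ring.
  by rewrite sqrtr_sqr normrM normfV (gtr0_norm c0).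
have cE : cos (acos (a / cmod z)) = a / cmod z by rewrite acosK.
have ge0 := acos_ge0 x1; have lepi := acos_lepi x1.
have pi0 : 0 < (pi : R) := pi_gt0 R.
rewrite /Arg -/a -/b; case: ifPn => [b0|]; [|rewrite -ltNge => b0].
  split; first by rewrite lepi andbT; lra.
  rewrite /expi sE cE ger0_norm // {1}zE; simpc.
  by congr (_ +i* _); field; rewrite gt_eqF.
split.
  have altpi : acos (a / cmod z) < pi.
    rewrite acos_ltpi //; case/andP: x1 => x1 ->; rewrite andbT lt_def x1 andbT.
    apply/eqP => x1'; move: x2; rewrite x1' sqrrN expr1n => /eqP.
    by rewrite -subr_eq0 addrAC subrr add0r sqrf_eq0 mulf_eq0 invr_eq0 (gt_eqF c0) (lt_eqF b0).
  by rewrite ltrN2 altpi /=; lra.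
rewrite /expi sinN cosN sE cE ltr0_norm // {1}zE; simpc.
by congr (_ +i* _); field; rewrite gt_eqF.
Qed.

Lemma polar z : exists2 x : R, - pi < x <= pi & z = (cmod z)%:C * expi x.
Proof.
have [->|z0] := eqVneq z 0.
  exists 0; last by rewrite cmod0 mul0r.
  by rewrite oppr_lt0 pi_gt0 pi_ge0.
by have [h1 h2] := Arg_bounds z0; exists (Arg z).
Qed.


Lemma cvgC_near (T : Type) (F : set_system T) (f : T -> C) (l : C) :
  f @ F --> l -> forall eps : R, 0 < eps -> \forall x \near F, cmod (f x - l) < eps.
Proof.
move=> fl eps e0; suff /fl : nbhs l [set w | cmod (w - l) < eps] by [].
by apply/nbhs_cmod; exists eps.
Qed.

Lemma near_cvgC (T : Type) (F : set_system T) {FF : Filter F} (f : T -> C) (l : C) :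
  (forall eps : R, 0 < eps -> \forall x \near F, cmod (f x - l) < eps) -> f @ F --> l.
Proof.
by move=> h P /nbhs_cmod[d d0 hd]; apply: filterS (h d d0) => x; exact: hd.
Qed.

Lemma cmodR (x : R) : cmod (x%:C) = `|x|.
Proof. by apply: complexI; rewrite cmodE normc_def /= expr0n addr0 sqrtr_sqr. Qed.

Lemma continuous_realC : continuous (fun x : R => x%:C : C).
Proof.
move=> x; apply: near_cvgC => eps e0; apply/nbhs_normP; exists eps => // y.
by rewrite /ball_ /= distrC -rmorphB /= cmodR.
Qed.

Lemma continuous_cmod : continuous (@cmod R).
Proof.
move=> z P /nbhs_normP[eps e0 he]; apply/nbhs_cmod; exists eps => // w hw.
apply: he; apply: le_lt_trans hw; rewrite ler_norml; apply/andP; split.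
  have := cmodD (w - z) z; rewrite subrK; lra.
have := cmodD (z - w) w; rewrite subrK cmodBC; lra.
Qed.

Lemma expiE (x : R) : expi x = (cos x)%:C + 'i%C * (sin x)%:C :> C.
Proof. by rewrite /expi; simpc; rewrite ?addr0 ?add0r. Qed.

Lemma continuous_expi : continuous (@expi R).
Proof.
have -> : @expi R = (fun x => (cos x)%:C + 'i%C * (sin x)%:C).
  by apply/funext => x; exact: expiE.
move=> x; apply: cvgD.
  exact: (continuous_comp (@continuous_cos R x) (@continuous_realC (cos x))).
apply: cvgM; first exact: cvg_cst.
exact: (continuous_comp (@continuous_sin R x) (@continuous_realC (sin x))).
Qed.

Definition cdisk (c : C) (rho : R) : set C := [set z | cmod (z - c) <= rho].

Lemma compact_cdisk c rho : 0 <= rho -> compact (cdisk c rho).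
Proof.
move=> rho0.
have -> : cdisk c rho = (fun u : R * R => c + (u.1)%:C * expi u.2) @`
    (`[0, rho] `*` `[- pi, pi]).
  apply/seteqP; split=> [z /= hz|_ [[a x] /= [+ _] <-]].
    have [x /andP[x1 x2] zx] := polar (z - c).
    exists (cmod (z - c), x) => /=; last by rewrite -zx addrC subrK.
    by rewrite !in_itv /= cmod_ge0 hz (ltW x1).
  rewrite in_itv /= /cdisk => /andP[a0 ar].
  by rewrite /= [c + _]addrC addrK cmodM cmod_expi mulr1 cmod_real.
apply: continuous_compact; last by apply: compact_setX; exact: segment_compact.
apply: continuous_subspaceT => u; apply: cvgD; first exact: cvg_cst.
apply: cvgM.
  apply: (@continuous_comp _ _ _ fst (fun y : R => y%:C : C)); first exact: cvg_fst.
  exact: continuous_realC.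
apply: (@continuous_comp _ _ _ snd (@expi R)); first exact: cvg_snd.
exact: continuous_expi.
Qed.

(** On the four points h, ih, -h, -ih the terms of degree 1 and 2 are orthogonal
    to each other and to the constants, so a square modulus averages to the sum of
    the squares of the coefficients. *)
Lemma four_points (a0 a1 a2 : C) (x : R) :
  let P h := cmod (a0 + a1 * h + a2 * h ^+ 2) ^+ 2 in
  let X : C := x%:C in
  P X + P ('i%C * X) + P (- X) + P (- ('i%C * X)) =
  4 * (cmod a0 ^+ 2 + cmod a1 ^+ 2 * x ^+ 2 + cmod a2 ^+ 2 * x ^+ 4).
Proof.
rewrite /= !cmod_sqr !expr2.
by case: a0 => a b; case: a1 => c d; case: a2 => e f; simpc => /=; ring.
Qed.

End Polar.

(** * The maximum principle *)

Section MaximumPrinciple.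
Variable R : realType.
Local Notation C := (CC R).
Implicit Types (z w : C) (f : C -> C).

Lemma cmod_sqr_lower (a b : C) (M K : R) : cmod b <= M -> cmod (a - b) <= K ->
  cmod b ^+ 2 - 2 * M * K <= cmod a ^+ 2.
Proof.
move=> bM abK; have ab := cmodB a (a - b); rewrite opprB addrC subrK in ab.
have := cmod_ge0 a; have := cmod_ge0 b; have := cmod_ge0 (a - b).
move: ab abK bM; set x := cmod a; set y := cmod b; set e := cmod (a - b).
move=> h1 h2 h3 e0 y0 x0.
have h4 : y * e <= M * K by apply: ler_pM.
have [ye|ye] := leP e y.
  have : (y - e) ^+ 2 <= x ^+ 2 by rewrite ler_sqr ?nnegrE ?subr_ge0 //; lra.
  by have := sqr_ge0 e; nra.
have : y * y <= y * e by apply: ler_wpM2l => //; exact: ltW.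
by have := sqr_ge0 x; nra.
Qed.

(** Adding eps |z - c|^2 makes the square modulus strictly subharmonic: its mean
    over four symmetric points near z0 exceeds its value at z0. *)
Lemma no_local_max f z0 c (eps : R) : regular f z0 -> 0 < eps ->
  ~ near0 (fun h => cmod (f (z0 + h)) ^+ 2 + eps * cmod (z0 + h - c) ^+ 2
                    <= cmod (f z0) ^+ 2 + eps * cmod (z0 - c) ^+ 2).
Proof.
move=> /(_ 3%N)[p fp] e0 hmax.
pose q := (p`_0)%:P + p`_1 *: 'X + p`_2 *: 'X^2.
have fq : taylor 3 f z0 q.
  apply: taylor_poly fp => k k3.
  rewrite /q !coefD !coefZ coefC coefX coefXn.
  by case: k k3 => [|[|[|k]]] //= _; ring.
have qE h : q.[h] = p`_0 + p`_1 * h + p`_2 * h ^+ 2 by rewrite /q !hornerE.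
have f0 : f z0 = p`_0 by rewrite (taylor0 fp).
have [K K0 hK] := bigOP fq; have [M M0 hM] := bigOP (bigO_poly q).
have [d d0 hd] := near0I hmax (near0I hK hM).
(* Small enough for the cubic error 8 M K x^3 to stay below the gain 4 eps x^2. *)
pose x := Num.min (d / 2) (eps / (4 * M * K)).
have MK0 : 0 < 4 * M * K by rewrite !mulr_gt0.
have x0 : 0 < x by rewrite lt_min !divr_gt0.
have xd : x < d by rewrite gt_min ltr_pdivrMr // mulr_natr mulr2n ltrDl d0.
have xe : 4 * M * K * x <= eps.
  by rewrite mulrC -ler_pdivlMr // ge_min lexx orbT.
have key h : cmod h = x -> cmod (q.[h]) ^+ 2 - 2 * M * (K * x ^+ 3) +
    eps * cmod (z0 - c + 1 * h + 0 * h ^+ 2) ^+ 2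
    <= cmod p`_0 ^+ 2 + eps * cmod (z0 - c) ^+ 2.
  move=> hx; have hh : cmod h < d by rewrite hx.
  have [h1 []] := hd _ hh; rewrite expr0 mulr1 hx => h2 h3.
  apply: le_trans; last by rewrite -f0; exact: h1.
  rewrite mul1r mul0r addr0 [z0 + h - c]addrAC lerD2r.
  exact: cmod_sqr_lower.
have xC : cmod (x%:C : C) = x by apply: cmod_real; exact: ltW.
have iC : cmod ('i%C * x%:C : C) = x.
  by rewrite -[X in _ = X]mul1r cmodM xC /cmod normc_def /= expr0n add0r expr1n sqrtr1.
have h1 := key _ xC; have h2 := key _ iC.
have h3 : _ := key (- x%:C) (etrans (cmodN _) xC).
have h4 : _ := key (- ('i%C * x%:C)) (etrans (cmodN _) iC).
have := four_points p`_0 p`_1 p`_2 x; have := four_points (z0 - c) 1 0 x.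
rewrite /= -!qE cmod1 cmod0.
move: h1 h2 h3 h4.
set D1 := cmod (_ + 1 * x%:C + _) ^+ 2; set D2 := cmod (_ + 1 * ('i%C * x%:C) + _) ^+ 2.
set D3 := cmod (_ + 1 * (- x%:C) + _) ^+ 2.
set D4 := cmod (_ + 1 * (- ('i%C * x%:C)) + _) ^+ 2.
move=> h1 h2 h3 h4 hD hQ.
have {}hD : eps * D1 + eps * D2 + eps * D3 + eps * D4 =
    4 * (eps * cmod (z0 - c) ^+ 2 + eps * x ^+ 2) by rewrite -!mulrDr hD; ring.
have a1 : 0 <= cmod p`_1 ^+ 2 * x ^+ 2 by rewrite mulr_ge0 ?sqr_ge0.
have a2 : 0 <= cmod p`_2 ^+ 2 * x ^+ 4 by rewrite mulr_ge0 ?sqr_ge0 // exprn_ge0 // ltW.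
have x2 : 0 < eps * x ^+ 2 by rewrite mulr_gt0 // exprn_gt0.
have x3 : 2 * x ^+ 2 * (4 * M * K * x) <= 2 * x ^+ 2 * eps.
  by rewrite ler_wpM2l // mulr_ge0 // sqr_ge0.
have x3E : 2 * x ^+ 2 * (4 * M * K * x) = 4 * (2 * M * (K * x ^+ 3)) by ring.
by rewrite x3E in x3; lra.
Qed.

Lemma regular_continuous f z : regular f z -> {for z, continuous f}.
Proof.
move=> rf P /nbhs_cmod[d d0 hd]; apply/near0_nbhs.
by apply: near0W (regular_cont rf d0) => h; exact: hd.
Qed.

(** The function |f|^2 + eps |z - c|^2 attains its maximum over the compact disk,
    necessarily on the circle; then eps tends to 0. *)
Theorem maximum_principle f c (rho M : R) : 0 <= rho ->
  (forall z, cmod (z - c) <= rho -> regular f z) ->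
  (forall z, cmod (z - c) = rho -> cmod (f z) <= M) ->
  forall z, cmod (z - c) <= rho -> cmod (f z) <= M.
Proof.
move=> rho0 rf fM z1 hz1.
have M0 : 0 <= M.
  apply: le_trans (cmod_ge0 _) (fM (c + rho%:C) _).
  by rewrite addrC addKr cmod_real.
suff H (eps : R) : 0 < eps -> cmod (f z1) ^+ 2 <= M ^+ 2 + eps * rho ^+ 2.
  rewrite -ler_sqr ?nnegrE ?cmod_ge0 //; apply/ler_addgt0Pr => e e0.
  have r1 : 0 < rho ^+ 2 + 1 by rewrite ltr_wpDl // sqr_ge0.
  apply: le_trans (H _ (divr_gt0 e0 r1)) _.
  rewrite lerD2l mulrAC ler_pdivrMr // ler_pM2l // lerDl ler01 //.
move=> e0; pose phi z := cmod (f z) ^+ 2 + eps * cmod (z - c) ^+ 2.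
have cphi : {within cdisk c rho, continuous phi}.
  apply: continuous_in_subspaceT => z /set_mem zD.
  have cz : {for z, continuous (fun w => cmod (f w))}.
    apply: continuous_comp (@continuous_cmod R (f z)).
    exact: regular_continuous (rf _ zD).
  have cc : {for z, continuous (fun w => cmod (w - c))}.
    apply: (@continuous_comp _ _ _ (fun w : C => w - c) (@cmod R) z) (@continuous_cmod R _).
    exact: regular_continuous (regularB (regular_id z) (regular_cst c z)).
  have -> : phi = (fun w => cmod (f w)) * (fun w => cmod (f w)) +
      cst eps * ((fun w => cmod (w - c)) * (fun w => cmod (w - c))) by [].
  apply: continuousD; first exact: continuousM.
  by apply: continuousM; [exact: cst_continuous|exact: continuousM].
have [|z0 /set_mem z0D zmax] := compact_EVT_max _ (compact_cdisk (c := c) rho0) cphi.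
  by exists z1.
have [z0rho|z0rho] := ltP (cmod (z0 - c)) rho.
  exfalso; apply: (no_local_max (rf _ z0D) e0 (c := c)).
  exists (rho - cmod (z0 - c)); first by rewrite subr_gt0.
  move=> h hh; apply: zmax; apply/mem_set; rewrite /cdisk /=.
  by rewrite addrAC (le_trans (cmodD _ _)) //; lra.
have {}z0rho : cmod (z0 - c) = rho by apply/eqP; rewrite eq_le z0rho andbT.
have : phi z1 <= phi z0 by apply: zmax; apply/mem_set.
rewrite /phi z0rho; have := fM _ z0rho; have := cmod_ge0 (f z0).
have := sqr_ge0 (cmod (z1 - c)); nra.
Qed.

End MaximumPrinciple.

(** * Power series and complex derivatives *)

Section Analytic.
Variable R : realType.
Local Notation C := (CC R).
Implicit Types (z w h : C) (f : C -> C).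

Lemma geometric_tail (q : R) n j : 0 <= q <= 1 / 2 ->
  \sum_(n <= k < n + j) q ^+ k <= 2 * q ^+ n.
Proof.
move=> /andP[q0 q2].
suff H : \sum_(n <= k < n + j) q ^+ k + 2 * q ^+ (n + j) <= 2 * q ^+ n.
  by apply: le_trans H; rewrite lerDl mulr_ge0 // exprn_ge0.
elim: j => [|j IH]; first by rewrite addn0 big_geq // add0r.
rewrite addnS big_nat_recr ?leq_addr //=; apply: le_trans IH.
rewrite -addrA lerD2l exprS.
have : 0 <= q ^+ (n + j) by rewrite exprn_ge0.
by set x := q ^+ _; nra.
Qed.

Lemma cmod_sum (F : nat -> C) m n :
  cmod (\sum_(m <= k < n) F k) <= \sum_(m <= k < n) cmod (F k).
Proof.
elim/big_ind2: _ => [|x a y b xa yb|k _]; rewrite ?cmod0 //.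
by rewrite (le_trans (cmodD _ _)) // lerD.
Qed.

Lemma cvg_series_terms_bounded (u : nat -> C) (l : C) : [series u k]_k @ \oo --> l ->
  exists2 M : R, 0 < M & forall k, cmod (u k) <= M.
Proof.
move=> /cvgC_near /(_ 1 ltr01) [N _ hN].
have hk k : (N <= k)%N -> cmod (u k) <= 2.
  move=> Nk; have := hN _ Nk; have := hN k.+1 (leqW Nk); rewrite /= /series /=.
  rewrite big_nat_recr //=; set S := \sum_(_ <= _ < _) _ => h1 h2.
  have -> : u k = (S + u k - l) - (S - l) by ring.
  by apply: (le_trans (cmodB _ _)); lra.
exists (2 + \sum_(0 <= k < N) cmod (u k)).
  by rewrite ltr_wpDr // sumr_ge0 // => *; exact: cmod_ge0.
move=> k; have [Nk|kN] := leqP N k.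
  rewrite (le_trans (hk _ Nk)) // lerDl sumr_ge0 // => *; exact: cmod_ge0.
rewrite big_mkord (bigD1 (Ordinal kN)) //= addrCA lerDl addr_ge0 //.
by rewrite sumr_ge0 // => *; exact: cmod_ge0.
Qed.

(** The terms are bounded at one point x, so closer to the center the tail of order
    n is dominated by a geometric series. *)
Lemma power_series_regular f z (a : nat -> C) :
  near0 (fun h => [series a k * h ^+ k]_k @ \oo --> f (z + h)) -> regular f z.
Proof.
move=> [d d0 hd] n; exists (\poly_(k < n) a k).
have [x x0 x_lt_d] : exists2 x : R, 0 < x & x < d.
  by exists (d / 2); [rewrite divr_gt0|lra].
have xd : cmod (x%:C : C) < d.
  by rewrite cmod_real // ltW.
have [M M0 hM] := cvg_series_terms_bounded (hd _ xd).
have ha k : cmod (a k) <= M / x ^+ k.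
  rewrite ler_pdivlMr ?exprn_gt0 //; apply: le_trans (hM k).
  by rewrite cmodM cmodX cmod_real // ltW.
exists (2 * M / x ^+ n); exists (x / 2); first by rewrite divr_gt0.
move=> h hx; apply/ler_addgt0Pr => e e0.
have hhd : cmod h < d by move: hx; lra.
have [N _ hN] := cvgC_near (hd _ hhd) e0.
have := hN (n + N)%N (leq_addl _ _); rewrite /= /series /= => hS.
set S := \sum_(_ <= _ < _) _ in hS.
have -> : f (z + h) - (\poly_(k < n) a k).[h] =
    (S - (\poly_(k < n) a k).[h]) - (S - f (z + h)) by ring.
apply: (le_trans (cmodB _ _)); apply: lerD; last exact: ltW.
rewrite horner_poly /S -(big_mkord predT (fun i => a i * h ^+ i)).
rewrite (@big_cat_nat _ _ _ n) ?leq_addr //= addrAC subrr add0r.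
apply: (le_trans (cmod_sum _ _ _)).
apply: (@le_trans _ _ (\sum_(n <= k < n + N) M * (cmod h / x) ^+ k)).
  apply: ler_sum => k _; rewrite cmodM cmodX expr_div_n.
  have hk0 : 0 <= cmod h ^+ k by rewrite exprn_ge0 ?cmod_ge0.
  by apply: (le_trans (ler_wpM2r hk0 (ha k))); rewrite mulrAC mulrA.
have -> : 2 * M / x ^+ n * cmod h ^+ n = M * (2 * (cmod h / x) ^+ n).
  by rewrite expr_div_n; field; rewrite expf_neq0 // gt_eqF.
rewrite -big_distrr ler_pM2l //; apply: geometric_tail.
rewrite divr_ge0 ?cmod_ge0 ?(ltW x0) //= ler_pdivrMr //.
by move: hx; lra.
Qed.

Lemma analytic_regular (D : set C) f z : analytic_on D f -> D z -> regular f z.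
Proof.
move=> fD /fD[a /near0_nbhs ha]; apply: (@power_series_regular _ _ a).
by apply: near0W ha => h /=; rewrite addrAC subrr add0r.
Qed.

Lemma derive1_regular f z : regular f z -> (f^`())%classic z = tcoef f z 1.
Proof.
move=> rf; have [p fp] := rf 2%N.
rewrite /derive1; apply: (cvg_lim (@norm_hausdorff _ C)).
apply: near_cvgC => eps e0.
have pO : bigO 2 (fun h => f (z + h) - f z - tcoef f z 1 * h).
  have fq : taylor 2 f z ((f z)%:P + tcoef f z 1 *: 'X).
    apply: taylor_poly (fp) => -[|[|k]] //= _; rewrite coefD coefC coefZ coefX /=.
      by rewrite mulr0 addr0 (taylor0 fp).
    by rewrite mulr1 add0r (tcoefE fp).
  by apply: bigO_eq fq => h; rewrite hornerD hornerC hornerZ hornerX; ring.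
have [K K0 hK] := bigOP pO.
have : near0 (fun h => h != 0 ->
    cmod (h^-1 *: (f (h + z) - f z) - tcoef f z 1) < eps).
  apply: near0W (near0I hK (near0_lt (divr_gt0 e0 K0))) => h [h1 h2] h0.
  have ch0 : 0 < cmod h by rewrite cmod_gt0.
  have -> : h^-1 *: (f (h + z) - f z) - tcoef f z 1 =
      h^-1 * (f (z + h) - f z - tcoef f z 1 * h).
    by rewrite -[h^-1 *: _]/(h^-1 * _) [h + z]addrC; field.
  rewrite cmodM cmodV mulrC ltr_pdivrMr //; apply: le_lt_trans h1 _.
  by rewrite expr2 mulrA ltr_pM2r // mulrC -ltr_pdivlMr.
move=> H; have {H} : nbhs (0 : C) (fun h => h != 0 ->
    cmod (h^-1 *: (f (h + z) - f z) - tcoef f z 1) < eps).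
  by apply/near0_nbhs; move: H; apply: near0W => h; rewrite add0r.
exact.
Qed.

End Analytic.

(** * Divided differences and Cauchy's estimate *)

Section Divided.
Variable R : realType.
Local Notation C := (CC R).
Implicit Types (z w h c : C) (f : C -> C).

Definition divdiff f c z : C :=
  if z == c then tcoef f c 1 else (f z - f c) / (z - c).

Lemma divdiffE f c z : (z - c) * divdiff f c z = f z - f c.
Proof.
rewrite /divdiff; case: eqP => [->|/eqP zc]; first by rewrite !subrr mul0r.
by rewrite mulrC divfK // subr_eq0.
Qed.

Lemma tcoef_cst c z k : tcoef (fun=> c) z k.+1 = 0.
Proof.
rewrite (@tcoefE _ k.+2 _ _ c%:P) ?coefC //.
apply: bigO_eq (bigO_coef0 (p := 0) (n := k.+2) _) => [h|i _]; last by rewrite coef0.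
by rewrite horner0 hornerC subrr.
Qed.

Lemma regular_divdiff f c z : regular f c -> regular f z -> regular (divdiff f c) z.
Proof.
move=> rc rz; have [->|zc] := eqVneq z c.
  apply: (@regular_div _ (fun w => f w + - f c)).
  - exact: regularD rc (regular_cst _ _).
  - by exists 1 => // h _; have := divdiffE f c (c + h); rewrite addrAC subrr add0r.
  - rewrite tcoefD //; last exact: regular_cst.
    by rewrite tcoef_cst addr0 /divdiff eqxx.
have rq : regular (fun w => (f w - f c) * (w - c)^-1) z.
  apply: regularM; first exact: regularB rz (regular_cst _ _).
  apply: regularV; first by rewrite subr_eq0.
  exact: regularB (regular_id _) (regular_cst _ _).
apply: regular_near rq; have d0 : 0 < cmod (z - c) by rewrite cmod_gt0 subr_eq0.
apply: near0W (near0_lt d0) => h hh; rewrite /divdiff; case: eqP => // zhc.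
have hE : h = - (z - c) by rewrite -zhc; ring.
by move: hh; rewrite hE cmodN ltxx.
Qed.

(** Cauchy's estimate: the divided difference is bounded by 2M/rho on the circle,
    hence at its centre. *)
Lemma cauchy_estimate f c (rho M : R) : 0 < rho ->
  (forall z, cmod (z - c) <= rho -> regular f z /\ cmod (f z) <= M) ->
  cmod (tcoef f c 1) <= 2 * M / rho.
Proof.
move=> rho0 hf.
have cc : cmod (c - c) <= rho by rewrite subrr cmod0 ltW.
have -> : tcoef f c 1 = divdiff f c c by rewrite /divdiff eqxx.
apply: (@maximum_principle R (divdiff f c) c rho) => //; first exact: ltW.
  by move=> z hz; apply: regular_divdiff; [case: (hf c cc)|case: (hf z hz)].
move=> z hz; rewrite ler_pdivlMr // -hz mulrC -cmodM divdiffE.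
apply: (le_trans (cmodB _ _)); rewrite mulr2n mulrDl mul1r.
by apply: lerD; [case: (hf z)|case: (hf c)] => //; rewrite hz.
Qed.

Lemma deriv_coef1 (p : {poly C}) h : (p \Po ('X + h%:P))`_1 = (p^`()).[h].
Proof.
have <- : ((p \Po ('X + h%:P))^`()).[0] = (p \Po ('X + h%:P))`_1.
  by rewrite horner_coef0 coef_deriv mulr1n.
by rewrite deriv_comp derivD derivX derivC addr0 mulr1 horner_comp !hornerE.
Qed.

(** The remainder E of order n + 2 is O(|h|^(n+2)) on the disk of center z + h and
    radius |h|/2, where Cauchy's estimate gives E' = O(|h|^(n+1)): an expansion of
    f may be differentiated term by term. *)
Lemma regular_derive1 f z (rho : R) : 0 < rho ->
  (forall w, cmod (w - z) <= rho -> regular f w) ->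
  regular (f^`())%classic z /\
  forall k, tcoef (f^`())%classic z k = tcoef f z k.+1 *+ k.+1.
Proof.
move=> rho0 rf.
have rz : regular f z by apply: rf; rewrite subrr cmod0 ltW.
suff key n p : taylor n.+2 f z p -> taylor n.+1 (f^`())%classic z p^`().
  split=> [n|k].
    have [p fp] := rz n.+2; exists p^`(); apply: bigO_le (leqnSn n) _; exact: key.
  have [p fp] := rz k.+2.
  by rewrite (tcoefE (key _ _ fp)) // coef_deriv (tcoefE fp).
move=> fp; have [K K0 hK] := bigOP fp.
have [d d0 {}hK] := near0I hK (near0_lt rho0).
exists (4 * K * 2 ^+ n.+2); exists (d / 2); first by rewrite divr_gt0.
move=> h hd; have [->|h0] := eqVneq h 0.
  rewrite addr0 derive1_regular // (tcoefE fp) // horner_coef0 coef_deriv mulr1n.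
  by rewrite subrr cmod0 expr0n mulr0.
have ch0 : 0 < cmod h by rewrite cmod_gt0.
have rzh : regular f (z + h).
  by apply: rf; rewrite addrAC subrr add0r ltW // (hK h _).2 //; lra.
pose E w := f w + (- p \Po ('X - z%:P)).[w].
have rE w : regular f w -> regular E w.
  by move=> rw; apply: regularD => //; exact: regular_horner.
have -> : (f^`())%classic (z + h) - (p^`()).[h] = tcoef E (z + h) 1.
  rewrite derive1_regular //.
  rewrite /E tcoefD //; last exact: regular_horner.
  rewrite tcoef_horner -comp_polyA.
  have -> : ('X - z%:P) \Po ('X + (z + h)%:P) = 'X + h%:P.
    rewrite comp_polyB comp_polyX comp_polyC polyCD; ring.
  by rewrite deriv_coef1 derivN hornerN.
have := @cauchy_estimate E (z + h) (cmod h / 2) (K * (2 * cmod h) ^+ n.+2) _ _.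
move=> H; apply: le_trans (H _ _) _.
- by rewrite divr_gt0.
- move=> w hw; have hwz : cmod (w - z) <= 3 / 2 * cmod h.
    have -> : w - z = (w - (z + h)) + h by ring.
    by apply: (le_trans (cmodD _ _)); lra.
  have wd : cmod (w - z) < d by lra.
  have [] := hK _ wd; rewrite [z + (w - z)]addrC subrK => h1 h2; split.
    by apply: rE; apply: rf; exact: ltW.
  have -> : E w = f w - p.[w - z] by rewrite /E horner_comp !hornerE.
  apply: le_trans h1 _; rewrite ler_pM2l //.
  by apply: lerXn2r; rewrite ?nnegrE ?cmod_ge0 ?mulr_ge0 ?cmod_ge0 //; lra.
- rewrite exprMn [cmod h ^+ n.+2]exprS.
  have -> : 2 * (K * (2 ^+ n.+2 * (cmod h * cmod h ^+ n.+1))) / (cmod h / 2) =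
    4 * K * 2 ^+ n.+2 * cmod h ^+ n.+1 by field; rewrite gt_eqF.
  exact: lexx.
Qed.
End Divided.

(** * Termwise differentiation and Schur's algorithm on Taylor coefficients *)

Section SchwarzPick.
Variable R : realType.
Local Notation C := (CC R).
Implicit Types (z w h c : C) (f g : C -> C).

Definition regular_disk f := forall z, cmod z < 1 -> regular f z.

Lemma derive1_regular_disk f : regular_disk f ->
  regular_disk (f^`())%classic /\ forall z k, cmod z < 1 ->
    tcoef (f^`())%classic z k = tcoef f z k.+1 *+ k.+1.
Proof.
move=> rf; suff H z : cmod z < 1 -> regular (f^`())%classic z /\
    forall k, tcoef (f^`())%classic z k = tcoef f z k.+1 *+ k.+1.
  by split=> [z /H[]|z k /H[]].
move=> z1; have rho0 : 0 < (1 - cmod z) / 2 by lra.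
apply: (regular_derive1 rho0) => w hw; apply: rf.
by have := cmodD (w - z) z; rewrite subrK; lra.
Qed.

Lemma derive3_regular_disk f z : regular_disk f -> cmod z < 1 ->
  (f^`(3))%classic z = tcoef f z 3 * 6.
Proof.
move=> rf z1; rewrite !derive1nS derive1n0.
have [rf1 h1] := derive1_regular_disk rf; have [rf2 h2] := derive1_regular_disk rf1.
rewrite derive1_regular; last exact: rf2.
by rewrite h2 // h1 // mulr_natr -mulrnA.
Qed.

Lemma taylor_exact n f z (p : {poly C}) : (forall h, f (z + h) = p.[h]) -> taylor n f z p.
Proof.
move=> fp; apply: bigO_eq (bigO_coef0 (p := 0) (n := n) _) => [h|k _].
  by rewrite horner0 fp subrr.
by rewrite coef0.
Qed.

(** Both sides of the Schur relation are products of explicit Taylor polynomials;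
    the coefficients of order 0 to 3 are compared. *)
Lemma schur_coefs g g1 a c : regular g a -> regular g1 a -> cmod a < 1 ->
  near0 (fun h => h * g1 (a + h) * (1 - c^* * g (a + h)) =
                  (1 - a^* * (a + h)) * (g (a + h) - c)) ->
  let D := 1 - a^* * a in let k := tcoef g a in let l := tcoef g1 a in
  [/\ D * (k 0%N - c) = 0,
      D * k 1%N - a^* * (k 0%N - c) = l 0%N * (1 - c^* * k 0%N),
      D * k 2%N - a^* * k 1%N = l 1%N * (1 - c^* * k 0%N) - l 0%N * c^* * k 1%N &
      D * k 3%N - a^* * k 2%N =
        l 2%N * (1 - c^* * k 0%N) - l 1%N * c^* * k 1%N - l 0%N * c^* * k 2%N].
Proof.
move=> rg rg1 a1 hE D k l.
have [p gp] := rg 4%N; have [q g1q] := rg1 4%N.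
have cst4 (b : C) : taylor 4 (fun=> b) a b%:P by apply: taylor_exact => h; rewrite hornerC.
have X4 : taylor 4 (fun w => w - a) a 'X.
  by apply: taylor_exact => h; rewrite hornerX addrAC subrr add0r.
have A4 : taylor 4 (fun w => 1 - a^* * w) a (D%:P - a^* *: 'X).
  by apply: taylor_exact => h; rewrite !hornerE /D; ring.
have L4 := taylorM (taylorM X4 g1q) (taylorD (cst4 1) (taylorM (cst4 (- c^*)) gp)).
have R4 := taylorM A4 (taylorD gp (cst4 (- c))).
have {L4}L4 : taylor 4 (fun w => (1 - a^* * w) * (g w + - c)) a
    ('X * q * (1%:P + (- c^*)%:P * p)).
  apply: taylor_near L4; apply: near0W hE => h; rewrite [a + h - a]addrAC subrr add0r.
  by rewrite mulNr.
have {L4 R4}E n (n4 : (n < 4)%N) := taylor_uniq L4 R4 n4.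
have rE n : (1%:P + (- c^*)%:P * p)`_n = (n == 0)%:R - c^* * p`_n.
  by rewrite coefD coefC coefCM; case: n => [|n] /=; ring.
have uE n : (p + (- c)%:P)`_n = p`_n - (if n == 0%N then c else 0).
  by rewrite coefD coefC; case: n => [|n] /=; ring.
have {}E n (n4 : (n < 4)%N) : (if n == 0%N then 0 else
    (q * (1%:P + (- c^*)%:P * p))`_n.-1) =
    D * (p`_n - (if n == 0%N then c else 0)) -
    a^* * (if n == 0%N then 0 else (p`_n.-1 - (if n.-1 == 0%N then c else 0))).
  rewrite -!uE -coefXM mulrA E // mulrBl coefB coefCM -scalerAl coefZ coefXM.
  by [].
have pk n (n4 : (n < 4)%N) : k n = p`_n by rewrite /k (tcoefE gp).
have ql n (n4 : (n < 4)%N) : l n = q`_n by rewrite /l (tcoefE g1q).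
have := E 0%N isT; have := E 1%N isT; have := E 2%N isT; have := E 3%N isT.
rewrite /= !coefM !big_ord_recr !big_ord0 /= !rE -!ql // -!pk //.
rewrite /= !subr0 !add0r !mulr0 !subr0.
move=> E3 E2 E1 <-; split => //; rewrite -?E1 -?E2 -?E3; ring.
Qed.
End SchwarzPick.

(** * Schur's algorithm *)

Section SchwarzPick.
Variable R : realType.
Local Notation C := (CC R).
Implicit Types (x y b z w h c : C) (f g : C -> C).

Lemma cmod_mobius x y b :
  cmod (y + b^* * x) ^+ 2 - cmod (x + b * y) ^+ 2 =
  (1 - cmod b ^+ 2) * (cmod y ^+ 2 - cmod x ^+ 2).
Proof.
rewrite !cmod_sqr !expr2 conjE.
by case: x => x1 x2; case: y => y1 y2; case: b => b1 b2; simpc => /=; ring.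
Qed.

Lemma cmod_le_sqr x y : (cmod x <= cmod y) = (cmod x ^+ 2 <= cmod y ^+ 2).
Proof. by rewrite ler_sqr ?nnegrE ?cmod_ge0. Qed.

Lemma cmod_mobius_le x y b : cmod b <= 1 -> cmod x <= cmod y ->
  cmod (x + b * y) <= cmod (y + b^* * x).
Proof.
rewrite [cmod b <= 1](_ : _ = (cmod b ^+ 2 <= 1)); last first.
  by rewrite -{2}(expr1n _ 2) ler_sqr ?nnegrE ?cmod_ge0.
rewrite !cmod_le_sqr -subr_ge0 => b1; rewrite -subr_ge0 => xy.
by rewrite -subr_ge0 cmod_mobius mulr_ge0.
Qed.

Lemma mobius_neq0 x y b : cmod b <= 1 -> cmod x < cmod y -> y + b^* * x != 0.
Proof.
move=> b1 xy; apply/eqP => h.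
have yE : y = - (b^* * x) by apply/eqP; rewrite -addr_eq0 h.
move: xy; rewrite yE cmodN cmodM cmodJ ltNge => /negP; apply.
by rewrite ler_piMl ?cmod_ge0.
Qed.

Lemma cmod_blaschke x b :
  cmod (1 - b^* * x) ^+ 2 - cmod (x - b) ^+ 2 =
  (1 - cmod b ^+ 2) * (1 - cmod x ^+ 2).
Proof.
rewrite !cmod_sqr !expr2 conjE.
by case: x => x1 x2; case: b => b1 b2; simpc => /=; ring.
Qed.

Definition schur_class g := regular_disk g /\ forall z, cmod z < 1 -> cmod (g z) <= 1.

(** One step of Schur's algorithm; the bound on the new function is the maximum
    principle on circles of radius tending to 1, where the Blaschke factor
    has modulus tending to 1. *)
Lemma schur_step g a : schur_class g -> cmod a < 1 -> cmod (g a) < 1 ->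
  exists2 g1, schur_class g1 & forall z, cmod z < 1 ->
    (z - a) * g1 z * (1 - (g a)^* * g z) = (1 - a^* * z) * (g z - g a).
Proof.
move=> [rg gb] a1 ga1; set b := g a in ga1 *.
have den z : cmod z < 1 -> 1 - b^* * g z != 0.
  move=> /gb gz; apply/eqP => h.
  have : cmod (b^* * g z) = 1 by rewrite -[b^* * g z]add0r -[0]h subrK -?cmod1 ?cmod1 // opprK.
  have : cmod (b^* * g z) <= cmod b by rewrite cmodM cmodJ ler_piMr ?cmod_ge0.
  by lra.
pose G z := (g z - b) / (1 - b^* * g z).
have rG : regular_disk G.
  move=> z z1; apply: regularM.
    exact: regularB (rg _ z1) (regular_cst _ _).
  apply: regularV; first exact: den.
  apply: regularB (regular_cst _ _) _.
  exact: regularM (regular_cst _ _) (rg _ z1).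
have G1 z : cmod z < 1 -> cmod (G z) <= 1.
  move=> z1; rewrite /G cmodM cmodV ler_pdivrMr ?cmod_gt0 ?den // mul1r.
  rewrite cmod_le_sqr -subr_ge0 cmod_blaschke mulr_ge0 // subr_ge0.
    by rewrite -(expr1n _ 2) ler_sqr ?nnegrE ?cmod_ge0 // ltW.
  by rewrite -(expr1n _ 2) ler_sqr ?nnegrE ?cmod_ge0 // gb.
have Ga : G a = 0 by rewrite /G subrr mul0r.
pose g1 z := (1 - a^* * z) * divdiff G a z.
have g1E z : (z - a) * g1 z = (1 - a^* * z) * G z.
  by rewrite /g1 mulrCA divdiffE Ga subr0.
have rg1 : regular_disk g1.
  move=> z z1; apply: regularM.
    apply: regularB (regular_cst _ _) _.
    exact: regularM (regular_cst _ _) (regular_id _).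
  exact: regular_divdiff (rG _ a1) (rG _ z1).
exists g1; last first.
  by move=> z z1; rewrite g1E /G mulrA divfK // den.
split=> // z z1; apply/ler_addgt0Pr => e e0.
(* A lower bound for |w - a| on the circles of radius rho >= (1 + |a|) / 2. *)
pose kap := (1 - cmod a) / 2; have kap0 : 0 < kap by rewrite /kap; lra.
(* Close enough to 1 for 1 - rho^2 <= e kap^2. *)
pose rho := Num.max (Num.max ((1 + cmod a) / 2) (cmod z)) (1 - e * kap ^+ 2 / 2).
have rho1 : rho < 1.
  have ek : 0 < e * kap ^+ 2 / 2 by rewrite divr_gt0 // mulr_gt0 // exprn_gt0.
  rewrite !gt_max z1 andbT; apply/andP; split; first lra.
  by rewrite ltrBlDr ltrDl.
have rho_a : (1 + cmod a) / 2 <= rho by rewrite !le_max lexx.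
have rho_z : cmod z <= rho by rewrite !le_max lexx orbT.
have rho_e : 1 - e * kap ^+ 2 / 2 <= rho by rewrite !le_max lexx orbT.
have ca := cmod_ge0 a; have rho0 : 0 < rho by lra.
apply: (@maximum_principle R g1 0 rho); rewrite ?subr0 //; first exact: ltW.
  by move=> w; rewrite subr0 => hw; apply: rg1; exact: le_lt_trans hw rho1.
move=> w; rewrite subr0 => hw.
have w1 : cmod w < 1 by rewrite hw.
have wa : kap <= cmod (w - a).
  have := cmodD (w - a) a; rewrite subrK hw /kap; lra.
have wa0 : 0 < cmod (w - a) by exact: lt_le_trans wa.
have : cmod (w - a) * cmod (g1 w) <= cmod (1 - a^* * w).
  by rewrite -cmodM g1E cmodM ler_piMr ?cmod_ge0 // G1.
have := cmod_blaschke w a; rewrite hw.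
have := cmod_ge0 (g1 w); have := cmod_ge0 (1 - a^* * w).
move: wa wa0; set D := cmod (w - a); set N := cmod (1 - _); set x := cmod (g1 w).
move=> wa wa0 N0 x0 NE xN.
have x2 : D ^+ 2 * x ^+ 2 <= N ^+ 2.
  by rewrite -exprMn ler_sqr ?nnegrE ?mulr_ge0 // ltW.
have NE2 : N ^+ 2 <= D ^+ 2 * (1 + e).
  have h1 : 1 - rho ^+ 2 <= e * kap ^+ 2 by have := sqr_ge0 (1 - rho); nra.
  have h2 : e * kap ^+ 2 <= e * D ^+ 2.
    by rewrite ler_pM2l // ler_sqr ?nnegrE // ltW.
  have h3 : (1 - cmod a ^+ 2) * (1 - rho ^+ 2) <= 1 * (1 - rho ^+ 2).
    apply: ler_wpM2r; last by rewrite gerBl sqr_ge0.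
    by rewrite subr_ge0 -(expr1n _ 2) ler_sqr ?nnegrE ?ltW.
  by lra.
have x3 : x ^+ 2 <= 1 + e.
  have D2 : 0 < D ^+ 2 by rewrite exprn_gt0.
  by rewrite -(ler_pM2l D2); exact: le_trans NE2.
have : x ^+ 2 <= (1 + e) ^+ 2 by apply: le_trans x3 _; have := sqr_ge0 e; nra.
by rewrite ler_sqr ?nnegrE ?addr_ge0 // ltW.
Qed.

End SchwarzPick.

(** * The third derivative in terms of Schur parameters *)

Section Values.
Variable R : realType.
Local Notation C := (CC R).
Implicit Types (x y b z w h c : C) (f g : C -> C).

(** A Schur step bounds the derivative when |g a| < 1; scaling [g] by factors below
    1 covers a unimodular value, where the step is not defined. *)
Lemma schwarz_pick_deriv g a : schur_class g -> cmod a < 1 ->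
  (1 - cmod a ^+ 2) * cmod (tcoef g a 1) <= 1 - cmod (g a) ^+ 2.
Proof.
move=> [rg gb] a1; set x := _ * _; set y := _ ^+ 2; rewrite leNgt; apply/negP => xy.
have D0 : 0 < 1 - cmod a ^+ 2.
  by rewrite subr_gt0 -(expr1n _ 2) ltr_sqr ?nnegrE ?cmod_ge0.
have x0 : 0 <= x by rewrite mulr_ge0 ?cmod_ge0 // ltW.
have y0 : 0 <= y by exact: sqr_ge0.
have y1 : y <= 1 by rewrite -(expr1n _ 2) ler_sqr ?nnegrE ?cmod_ge0 ?gb.
(* The excess e of x over 1 - y survives the scaling by tau = 1 - u. *)
pose e := x - (1 - y); have e0 : 0 < e by rewrite subr_gt0.
pose u := e / (2 * (2 + x)); have u0 : 0 < u by rewrite divr_gt0 // mulr_gt0 //; lra.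
have ue : u * (2 * (2 + x)) = e by rewrite /u divfK // gt_eqF // mulr_gt0 //; lra.
have u1 : u < 1 by rewrite /u ltr_pdivrMr ?mulr_gt0 // /e; lra.
pose tau := 1 - u; have tau0 : 0 < tau by rewrite /tau; lra.
have ctau : cmod (tau%:C : C) = tau by apply: cmod_real; exact: ltW.
pose gt z := tau%:C * g z.
have gt1 z : cmod z < 1 -> cmod (gt z) < 1.
  move=> /gb gz; rewrite cmodM ctau; apply: le_lt_trans (_ : tau * 1 < 1).
    by rewrite ler_pM2l.
  by rewrite mulr1 /tau; lra.
have Sgt : schur_class gt.
  split=> [z z1|z /gt1/ltW //]; exact: regularM (regular_cst _ _) (rg _ z1).
have [g3 [rg3 g3b] E] := schur_step Sgt a1 (gt1 _ a1).
have rgt : regular gt a by exact: (proj1 Sgt).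
have Egt : near0 (fun h => h * g3 (a + h) * (1 - (gt a)^* * gt (a + h)) =
    (1 - a^* * (a + h)) * (gt (a + h) - gt a)).
  have a1' : 0 < 1 - cmod a by rewrite subr_gt0.
  apply: near0W (near0_lt a1') => h hh; rewrite -E.
    by rewrite addrAC subrr add0r.
  by apply: (le_lt_trans (cmodD _ _)); lra.
have [_ + _ _] := schur_coefs rgt (rg3 _ a1) a1 Egt.
rewrite tcoef0 // subrr mulr0 subr0 => E1.
have t1 : tcoef gt a 1 = tau%:C * tcoef g a 1.
  rewrite tcoefM ?big_ord_recr ?big_ord0 /=; first last.
  - exact: rg.
  - exact: regular_cst.
  by rewrite tcoef_cst mul0r addr0 add0r tcoef0 //; exact: regular_cst.
have sq (z : C) : 1 - z^* * z = (1 - cmod z ^+ 2)%:C.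
  by rewrite rmorphB /= cmod_sqrC mulrC.
have := congr1 (@cmod R) E1; rewrite t1 !sq !cmodM ctau.
have Dt : 0 <= 1 - (tau * cmod (g a)) ^+ 2.
  have := ltW (gt1 _ a1); rewrite /gt cmodM ctau => h.
  by rewrite subr_ge0 -(expr1n _ 2) ler_sqr ?nnegrE // mulr_ge0 ?cmod_ge0 // ltW.
rewrite !cmod_real ?(ltW D0) // mulrCA -/x => Ex.
have : tau * x <= 1 - tau ^+ 2 * y.
  rewrite Ex tcoef0; last exact: rg3.
  by rewrite /y -exprMn ler_piMl // g3b.
rewrite /tau; move: ue; rewrite /e; have := sqr_ge0 u; nra.
Qed.

Lemma tcoef_mulid f g a : regular g a ->
  near0 (fun h => f (a + h) = (a + h) * g (a + h)) ->
  tcoef f a 0 = a * tcoef g a 0 /\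
  forall k, tcoef f a k.+1 = a * tcoef g a k.+1 + tcoef g a k.
Proof.
move=> rg fg; have [p gp] := rg 0%N.
have key k q : taylor k.+1 g a q -> tcoef f a k = (a%:P * q + 'X * q)`_k.
  move=> gq; rewrite -mulrDl; apply: (@tcoefE _ k.+1) => //.
  have idT : taylor k.+1 id a (a%:P + 'X) by apply: taylor_exact => h; rewrite !hornerE.
  by apply: taylor_near (taylorM idT gq); apply: near0W fg.
split=> [|k].
  have [q gq] := rg 1%N; rewrite (key _ _ gq) (tcoefE gq) // coefD coefCM coefXM /=.
  by rewrite addr0.
have [q gq] := rg k.+2.
by rewrite (key _ _ gq) !(tcoefE gq) // coefD coefCM coefXM.
Qed.


(** Back substitution through three steps of Schur's algorithm, based at 0 and
    twice at the real point [a]. *)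
Lemma schur_chain_coef f g g1 g2 (a sg lam : C) :
  a^* = a -> sg^* = sg -> cmod a < 1 ->
  a != 0 -> 1 - a ^+ 2 != 0 -> 1 + a ^+ 2 - 2 * (a * sg) * lam != 0 ->
  regular g a -> regular g1 a -> regular g2 a ->
  near0 (fun h => f (a + h) = (a + h) * g (a + h)) ->
  near0 (fun h => h * g1 (a + h) * (1 - sg^* * g (a + h)) =
                  (1 - a^* * (a + h)) * (g (a + h) - sg)) ->
  near0 (fun h => h * g2 (a + h) * (1 - lam^* * g1 (a + h)) =
                  (1 - a^* * (a + h)) * (g1 (a + h) - lam)) ->
  let s := a * sg in let K := 1 + a ^+ 2 - 2 * s * lam in
  let zeta := g2 a in
  [/\ tcoef f a 0 = s,
   tcoef f a 1 = sg + (a ^+ 2 - s ^+ 2) / (a * (1 - a ^+ 2)) * lam &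
   tcoef f a 3 * 6 = 6 * (a ^+ 2 - s ^+ 2) / (a ^+ 3 * (1 - a ^+ 2) ^+ 3) *
     (s ^+ 2 * lam ^+ 3 - s * (1 + a ^+ 2) * lam ^+ 2 + a ^+ 2 * lam +
      a * (1 - lam * lam^*) * K * (zeta * (1 - a * lam^* / K * zeta) +
        a / K * ((1 - a ^+ 2) * tcoef g2 a 1)))].
Proof.
move=> aJ sJ a1 a0 D0 K0 rg rg1 rg2 /(tcoef_mulid rg)[f0 fS].
move=> /(schur_coefs rg rg1 a1) + /(schur_coefs rg1 rg2 a1).
rewrite /= aJ sJ f0 !fS (tcoef0 rg) (tcoef0 rg1) (tcoef0 rg2) -!expr2.
move: K0; set k0 := g _; set k1 := tcoef g _ 1; set k2 := tcoef g _ 2.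
set k3 := tcoef g _ 3; set l0 := g1 _; set l1 := tcoef g1 _ 1.
set l2 := tcoef g1 _ 2; set z0 := g2 _; set z1 := tcoef g2 _ 1; set lc := lam^*.
move: k0 k1 k2 k3 l0 l1 l2 z0 z1 lc => k0 k1 k2 k3 l0 l1 l2 z0 z1 lc K0.
move=> [/eqP + E1 E2 E3] [/eqP + F1 F2 F3].
rewrite !mulf_eq0 (negbTE D0) /= !subr_eq0 => /eqP k0E /eqP l0E.
move: E1 E2 E3 F1 F2; rewrite k0E l0E !subrr !mulr0 !subr0 -!expr2 => E1 E2 E3 F1 F2.
have l1E : l1 = z0 * (1 - lc * lam) / (1 - a ^+ 2).
  by apply: (mulfI D0); rewrite F1; field.
have l2E : l2 = (z1 * (1 - lc * lam) - z0 * lc * l1 + a * l1) / (1 - a ^+ 2).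
  by apply: (mulfI D0); rewrite -F2; field.
have k1E : k1 = lam * (1 - sg ^+ 2) / (1 - a ^+ 2).
  by apply: (mulfI D0); rewrite E1; field.
have k2E : k2 = (l1 * (1 - sg ^+ 2) - lam * sg * k1 + a * k1) / (1 - a ^+ 2).
  by apply: (mulfI D0); rewrite -E2; field.
have k3E : k3 = (l2 * (1 - sg ^+ 2) - l1 * sg * k1 - lam * sg * k2 + a * k2) / (1 - a ^+ 2).
  by apply: (mulfI D0); rewrite -E3; field.
split=> //.
  by rewrite k1E; field; rewrite D0 a0.
by rewrite k3E k2E l2E k1E l1E; field; rewrite D0 a0 K0.
Qed.

Variables (r s : R) (lam : C).
Hypothesis (hs : 0 <= s) (hsr : s < r) (hr : r < 1) (hlam : cmod lam < 1).

Definition eta_den : C := 1 + r%:C ^+ 2 - 2 * s%:C * lam.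

Lemma eta_den_neq0 : eta_den != 0.
Proof.
apply/eqP => h.
have : 1 + r ^+ 2 <= 2 * s * cmod lam.
  have -> : 1 + r ^+ 2 = cmod (2 * s%:C * lam).
    have -> : 2 * s%:C * lam = (1 + r ^+ 2)%:C.
      by rewrite rmorphD rmorph1 rmorphXn /=; apply/eqP; rewrite eq_sym -subr_eq0 -/eta_den h.
    by rewrite cmod_real // addr_ge0 // sqr_ge0.
  have -> : 2 * s%:C = (2 * s)%:C :> C by rewrite rmorphM /= rmorph_nat.
  by rewrite cmodM cmod_real // mulr_ge0.
have : s * cmod lam <= s by rewrite ler_piMr // ltW.
by have := sqr_ge0 (1 - r); have := hsr; nra.
Qed.

Lemma coefA_complex : (coefA r s)%:C =
  6 * (r%:C ^+ 2 - s%:C ^+ 2) / (r%:C ^+ 3 * (1 - r%:C ^+ 2) ^+ 3) :> C.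
Proof.
by rewrite /coefA !(rmorphM, fmorphV, rmorphB, rmorphXn, rmorph_nat, rmorph1) /=.
Qed.

Lemma coefB_complex : Defs.coefB r s lam =
  s%:C ^+ 2 * lam ^+ 3 - s%:C * (1 + r%:C ^+ 2) * lam ^+ 2 + r%:C ^+ 2 * lam.
Proof.
by rewrite /Defs.coefB !(rmorphM, fmorphV, rmorphD, rmorphXn, rmorph_nat, rmorph1) /=.
Qed.

Lemma coefC_complex : Defs.coefC r s lam = r%:C * (1 - lam * lam^*) * eta_den.
Proof. by rewrite /Defs.coefC normCK. Qed.

Lemma etaE : eta r s lam = r%:C * lam^* / eta_den.
Proof. by []. Qed.

Lemma r_neq0 : (r%:C : C) != 0.
Proof. by rewrite -cmod_eq0 cmodR normr_eq0 gt_eqF //; apply: le_lt_trans hsr. Qed.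

Lemma r_gt0 : 0 < r. Proof. exact: le_lt_trans hsr. Qed.

Lemma r1_neq0 : 1 - (r%:C : C) ^+ 2 != 0.
Proof.
rewrite -rmorphXn -(rmorph1 (real_complex R)) -rmorphB -cmod_eq0 cmodR normr_eq0.
by rewrite gt_eqF // subr_gt0 -(expr1n _ 2) ltr_sqr ?nnegrE // ltW // r_gt0.
Qed.

Lemma cmod_r : cmod (r%:C : C) < 1.
Proof. by rewrite cmod_real // ltW // r_gt0. Qed.

Lemma H0_at_coef f g g1 g2 : regular g r%:C -> regular g1 r%:C -> regular g2 r%:C ->
  near0 (fun h => f (r%:C + h) = (r%:C + h) * g (r%:C + h)) ->
  near0 (fun h => h * g1 (r%:C + h) * (1 - ((s / r)%:C)^* * g (r%:C + h)) =
    (1 - (r%:C)^* * (r%:C + h)) * (g (r%:C + h) - (s / r)%:C)) ->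
  near0 (fun h => h * g2 (r%:C + h) * (1 - lam^* * g1 (r%:C + h)) =
    (1 - (r%:C)^* * (r%:C + h)) * (g1 (r%:C + h) - lam)) ->
  [/\ tcoef f r%:C 0 = s%:C,
   tcoef f r%:C 1 = (s / r)%:C + ((r ^+ 2 - s ^+ 2) / (r * (1 - r ^+ 2)))%:C * lam &
   tcoef f r%:C 3 * 6 = (coefA r s)%:C * (Defs.coefB r s lam + Defs.coefC r s lam *
    (cfun r s lam (g2 r%:C) + r%:C / eta_den * ((1 - r%:C ^+ 2) * tcoef g2 r%:C 1)))].
Proof.
move=> rg rg1 rg2 E0 E1 E2.
have rsE : r%:C * (s / r)%:C = s%:C :> C.
  by rewrite -rmorphM /= mulrC divfK // gt_eqF // r_gt0.
have K0 := eta_den_neq0; rewrite /eta_den -rsE in K0.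
have := schur_chain_coef (conjc_real r) (conjc_real (s / r)) cmod_r r_neq0 r1_neq0 K0
  rg rg1 rg2 E0 E1 E2.
rewrite /= rsE => -[-> -> ->]; split=> //.
  congr (_ + _ * _).
  by rewrite !(rmorphM, fmorphV, rmorphB, rmorphXn, rmorph1).
by rewrite coefA_complex coefB_complex coefC_complex /cfun etaE.
Qed.
End Values.

(** * Power series of rational functions *)

Section Rational.
Variable R : realType.
Local Notation C := (CC R).
Implicit Types (x y b z w h c : C) (p q P Q : {poly C}).

Definition bounded_coefs (M : R) p := forall i, cmod p`_i <= M.

Lemma bounded_coefs_exists p : exists2 M : R, 0 < M & bounded_coefs M p.
Proof.
exists (1 + \sum_(0 <= i < size p) cmod p`_i).
  by rewrite ltr_wpDr // sumr_ge0 // => *; exact: cmod_ge0.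
move=> i; have S0 : 0 <= \sum_(0 <= j < size p) cmod p`_j.
  by rewrite sumr_ge0 // => *; exact: cmod_ge0.
have [pi|ip] := leqP (size p) i; first by rewrite nth_default // cmod0 addr_ge0.
rewrite big_mkord (bigD1 (Ordinal ip)) //= addrCA lerDl addr_ge0 //.
by rewrite sumr_ge0 // => *; exact: cmod_ge0.
Qed.

Lemma horner_bounded (M : R) p N z : bounded_coefs M p -> (size p <= N)%N ->
  cmod z <= 1 -> cmod p.[z] <= N%:R * M.
Proof.
move=> pM pN z1; have M0 : 0 <= M by exact: le_trans (cmod_ge0 _) (pM 0%N).
rewrite horner_coef -(big_mkord predT (fun i => p`_i * z ^+ i)).
apply: (le_trans (cmod_sum _ _ _)); apply: (@le_trans _ _ (\sum_(0 <= i < size p) M)).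
  apply: ler_sum => i _; rewrite cmodM cmodX.
  by apply: le_trans (pM i); rewrite ler_piMr ?cmod_ge0 ?exprn_ile1 ?cmod_ge0.
rewrite sumr_const_nat subn0 -(mulr_natl M); apply: ler_wpM2r => //.
by rewrite ler_nat.
Qed.

(** Division by increasing powers: P = Q (a_0 + a_1 X + ...) with remainders
    X^n P_n, where the coefficients of P_n grow at most geometrically. *)
Definition divstep Q P : {poly C} :=
  drop_poly 1 (P - (P`_0 / Q`_0) *: Q).

Lemma divstepE Q P : Q`_0 != 0 ->
  P = (P`_0 / Q`_0) *: Q + divstep Q P * 'X.
Proof.
move=> Q0; apply/polyP => i; rewrite coefD coefZ coefMX coef_drop_poly.
case: i => [|i] /=; first by rewrite divfK ?addr0.
by rewrite addn1 coefB coefZ addrC subrK.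
Qed.

Lemma divstep_iter Q P n : Q`_0 != 0 ->
  P = Q * \sum_(0 <= k < n) ((iter k (divstep Q) P)`_0 / Q`_0) *: 'X^k
      + iter n (divstep Q) P * 'X^n.
Proof.
move=> Q0; elim: n => [|n IH]; first by rewrite big_geq // mulr0 add0r expr0 mulr1.
rewrite {1}IH big_nat_recr //= mulrDr -addrA; congr (_ + _).
rewrite {1}[iter n _ P](divstepE _ Q0) mulrDl exprS mulrA -scalerAl -scalerAr.
by [].
Qed.

Lemma divstep_size Q P N n : (size P <= N)%N -> (size Q <= N)%N ->
  (size (iter n (divstep Q) P) <= N)%N.
Proof.
move=> PN QN; elim: n => [|n IH] //=; rewrite size_drop_poly.
apply: (leq_trans (leq_subr _ _)); apply: (leq_trans (size_polyD _ _)).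
by rewrite geq_max IH size_polyN (leq_trans (size_scale_leq _ _)).
Qed.

Lemma divstep_bound Q P (M B : R) n : Q`_0 != 0 -> bounded_coefs M P ->
  bounded_coefs B Q ->
  bounded_coefs (M * (1 + B / cmod Q`_0) ^+ n) (iter n (divstep Q) P).
Proof.
move=> Q0 PM QB; elim: n => [|n IH] i; first by rewrite expr0 mulr1.
rewrite /= /divstep coef_drop_poly coefB coefZ; apply: (le_trans (cmodB _ _)).
have q0 : 0 < cmod Q`_0 by rewrite cmod_gt0.
rewrite exprS mulrCA mulrDl mul1r; apply: lerD; first exact: IH.
rewrite !cmodM cmodV mulrAC [X in _ <= X]mulrC [X in _ <= X]mulrA.
by rewrite ler_pM2r ?invr_gt0 // ler_pM ?cmod_ge0 // IH.
Qed.

Lemma rational_power_series P Q z : Q.[z] != 0 ->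
  exists a : nat -> C, near0 (fun h =>
    [series a k * h ^+ k]_k @ \oo --> P.[z + h] / Q.[z + h]).
Proof.
move=> Qz; pose P' := P \Po ('X + z%:P); pose Q' := Q \Po ('X + z%:P).
have PE h : P.[z + h] = P'.[h] by rewrite /P' horner_comp !hornerE (addrC z).
have QE h : Q.[z + h] = Q'.[h] by rewrite /Q' horner_comp !hornerE (addrC z).
have Q0 : Q'`_0 != 0 by rewrite -horner_coef0 -QE addr0.
exists (fun k => (iter k (divstep Q') P')`_0 / Q'`_0).
have [M M0 hM] := bounded_coefs_exists P'; have [B B0 hB] := bounded_coefs_exists Q'.
pose N := maxn (size P') (size Q').
pose L := 1 + B / cmod Q'`_0.
have L0 : 0 < L by rewrite addr_gt0 // divr_gt0 // cmod_gt0.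
have L2 : 0 < (2 * L)^-1 by rewrite invr_gt0 mulr_gt0.
have Qz' : (horner Q) z != 0 by [].
have [bV nz] := bigO0_inv Qz' (taylor_horner 1 Q z).
apply: near0W (near0I nz (near0I (near0_lt ltr01) (near0_lt L2))) => h [hz [h1 hL]].
have Lh : L * cmod h <= 1 / 2.
  have : cmod h * (2 * L) <= 1 by rewrite -ler_pdivlMr ?mulr_gt0 // mul1r ltW.
  by lra.
pose c := N%:R * M / cmod Q'.[h].
have key n : cmod (series (fun k => (iter k (divstep Q') P')`_0 / Q'`_0 * h ^+ k) n -
    P.[z + h] / Q.[z + h]) <= c * (1 / 2) ^+ n.
  rewrite QE in hz; rewrite PE QE; pose S := \sum_(0 <= k < n)
    ((iter k (divstep Q') P')`_0 / Q'`_0) *: 'X^k.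
  have -> : series (fun k => (iter k (divstep Q') P')`_0 / Q'`_0 * h ^+ k) n = S.[h].
    by rewrite /series /S horner_sum; apply: eq_bigr => k _; rewrite hornerZ hornerXn.
  have -> : S.[h] - P'.[h] / Q'.[h] =
      - ((iter n (divstep Q') P').[h] * h ^+ n / Q'.[h]).
    rewrite [X in X.[h] / _](divstep_iter P' n Q0) -/S hornerD !hornerM hornerXn.
    by field.
  rewrite cmodN !cmodM cmodV cmodX /c [X in _ <= X]mulrAC ler_pM2r ?invr_gt0 ?cmod_gt0 //.
  have hb := horner_bounded (divstep_bound n Q0 hM hB)
    (divstep_size n (leq_maxl _ _) (leq_maxr _ _)) (ltW h1).
  apply: (le_trans (ler_wpM2r _ hb)); first by rewrite exprn_ge0 ?cmod_ge0.
  rewrite -/N -/L -!mulrA ler_wpM2l // ler_pM2l // -exprMn.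
  by apply: lerXn2r => //; rewrite nnegrE ?mulr_ge0 ?cmod_ge0 // ltW.
apply: near_cvgC => eps e0.
have : geometric c (1 / 2) n @[n --> \oo] --> (0 : R).
  by apply: cvg_geometric; rewrite ger0_norm //; lra.
move=> /cvgrPdist_lt /(_ _ e0); apply: filterS => n; rewrite sub0r normrN /=.
by move=> hn; apply: le_lt_trans (key n) _; apply: le_lt_trans hn; exact: ler_norm.
Qed.
End Rational.

(** * The set of values as a union of disks *)

Section Body.
Variable R : realType.
Local Notation C := (CC R).
Implicit Types (x y b z w h c : C) (f g : C -> C) (p q N D P Q : {poly C}).

Lemma unit_diskE z : unit_disk z <-> cmod z < 1.
Proof. by rewrite /unit_disk /= -cmodE -(ltcR (cmod z) 1). Qed.

Lemma rational_analytic P Q (A : set C) : (forall z, A z -> Q.[z] != 0) ->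
  analytic_on A (fun z => P.[z] / Q.[z]).
Proof.
move=> Q0 z /Q0 Qz; have [a ha] := rational_power_series P Qz; exists a.
apply/near0_nbhs; apply: near0W ha => h.
by have -> : z + h - z = h by rewrite addrAC subrr add0r.
Qed.

(** Inverse step of Schur's algorithm at [a], on fractions N / D of polynomials:
    the Blaschke factor of [a] times N / D, followed by the disk automorphism
    that maps 0 to [b]. *)
Definition unschur a b (F : {poly C} * {poly C}) : {poly C} * {poly C} :=
  let x := ('X - a%:P) * F.1 in let y := (1 - a^* *: 'X) * F.2 in
  (x + b *: y, y + b^* *: x).

Definition schur_frac (F : {poly C} * {poly C}) :=
  forall z, cmod z < 1 -> F.2.[z] != 0 /\ cmod F.1.[z] <= cmod F.2.[z].

Definition frac (F : {poly C} * {poly C}) z := F.1.[z] / F.2.[z].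

Lemma blaschke_lt a z : cmod a < 1 -> cmod z < 1 ->
  cmod (z - a) < cmod (1 - a^* * z).
Proof.
move=> a1 z1; rewrite -ltr_sqr ?nnegrE ?cmod_ge0 // -subr_gt0 cmod_blaschke.
by rewrite mulr_gt0 // subr_gt0 -(expr1n _ 2) ltr_sqr ?nnegrE ?cmod_ge0.
Qed.

Lemma horner_unschur a b F z :
  ((unschur a b F).1.[z] = (z - a) * F.1.[z] + b * ((1 - a^* * z) * F.2.[z])) *
  ((unschur a b F).2.[z] = (1 - a^* * z) * F.2.[z] + b^* * ((z - a) * F.1.[z])).
Proof.
have xE : ('X - a%:P).[z] = z - a by rewrite !hornerE.
have yE : (1 - a^* *: 'X).[z] = 1 - a^* * z by rewrite !hornerE.
by rewrite /unschur /= hornerD hornerZ !hornerM xE yE hornerD hornerZ !hornerM xE yE.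
Qed.

Lemma unschur_frac a b F : cmod a < 1 -> cmod b <= 1 -> schur_frac F ->
  schur_frac (unschur a b F).
Proof.
move=> a1 b1 hF z z1; have [D0 ND] := hF z z1; have xy := blaschke_lt a1 z1.
have lt : cmod ((z - a) * F.1.[z]) < cmod ((1 - a^* * z) * F.2.[z]).
  rewrite !cmodM; apply: (@le_lt_trans _ _ (cmod (z - a) * cmod F.2.[z])).
    by rewrite ler_wpM2l ?cmod_ge0.
  by rewrite ltr_pM2r // cmod_gt0.
rewrite !horner_unschur; split; first exact: (mobius_neq0 b1 lt).
by apply: cmod_mobius_le => //; exact: ltW.
Qed.

Lemma unschur_rel a b F z : cmod a < 1 -> cmod b <= 1 -> schur_frac F -> cmod z < 1 ->
  (z - a) * frac F z * (1 - b^* * frac (unschur a b F) z) =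
  (1 - a^* * z) * (frac (unschur a b F) z - b).
Proof.
move=> a1 b1 hF z1; have [D0 _] := hF z z1.
have [+ _] := unschur_frac a1 b1 hF z1; rewrite /frac !horner_unschur => D1.
by field; rewrite D0 D1.
Qed.

Lemma unschur_val a b F : cmod a < 1 -> cmod b <= 1 -> schur_frac F ->
  frac (unschur a b F) a = b.
Proof.
move=> a1 b1 hF; have := unschur_rel a1 b1 hF a1.
rewrite subrr !mul0r => /esym/eqP; rewrite mulf_eq0 => /orP[|].
  have := blaschke_lt a1 a1; rewrite subrr cmod0 cmod_gt0 => /negbTE -> //.
by rewrite subr_eq0 => /eqP.
Qed.

Lemma regular_frac F : schur_frac F -> regular_disk (frac F).
Proof.
move=> hF; have := @rational_analytic F.1 F.2 unit_disk.
move=> H z z1; apply: (@analytic_regular _ unit_disk); last exact/unit_diskE.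
by apply: H => w /unit_diskE/hF[].
Qed.

(** Up to an affine map, the set of values of f'''(r): z stands for the value at r of
    the second Schur transform of f, and the disk is swept out by its derivative. *)
Definition disk_union (e : C) (t : R) : set C :=
  [set p | exists2 z, cmod z <= 1 &
    cmod (p - z * (1 - e * z)) <= t * (1 - cmod z ^+ 2)].

Variables (r s : R) (lam : C).
Hypothesis (hs : 0 <= s) (hsr : s < r) (hr : r < 1) (hlam : cmod lam < 1).

Let rC : C := r%:C.

Lemma near_disk a (P : C -> Prop) : cmod a < 1 ->
  (forall z, cmod z < 1 -> P z) -> near0 (fun h => P (a + h)).
Proof.
move=> a1 H; have a0 : 0 < 1 - cmod a by rewrite subr_gt0.
apply: near0W (near0_lt a0) => h hh; apply: H.
by apply: (le_lt_trans (cmodD _ _)); lra.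
Qed.

Lemma tparE : tpar r s lam = cmod (r%:C / eta_den r s lam).
Proof. by rewrite cmodM cmodV cmod_real // ltW // (r_gt0 hs hsr). Qed.

(** Three Schur steps, at 0 and twice at r, followed by the Schwarz-Pick inequality
    for the derivative of the last function. *)
Lemma Vset_values f : H0_at r s lam f -> exists2 w,
  disk_union (eta r s lam) (tpar r s lam) w &
  (f^`(3))%classic r%:C = (coefA r s)%:C * (Defs.coefB r s lam + Defs.coefC r s lam * w).
Proof.
move=> [[fa fD f0] fr f'r].
have rf : regular_disk f.
  by move=> z z1; apply: (analytic_regular fa); exact/unit_diskE.
have Sf : schur_class f.
  by split=> // z /unit_diskE/fD/unit_diskE/ltW.
have r1 : cmod (r%:C : C) < 1 by exact: cmod_r hsr hr.
have z1 : cmod (0 : C) < 1 by rewrite cmod0.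
have [g Sg Eg] := schur_step Sf z1 (eq_ind_r (fun x => cmod x < 1) z1 f0).
have {}Eg z : cmod z < 1 -> f z = z * g z.
  move=> hz; have := Eg z hz; rewrite f0 conjC0 !mul0r !subr0 !mulr1 mul1r => <- //.
have r_gt0 := r_gt0 hs hsr.
have gr : g r%:C = (s / r)%:C.
  apply: (mulfI (r_neq0 hs hsr)); rewrite -Eg // fr -rmorphM /=.
  by rewrite mulrC divfK // gt_eqF.
have sr1 : cmod (g r%:C) < 1.
  by rewrite gr cmod_real ?divr_ge0 // ?ltr_pdivrMr ?mul1r // ltW.
have [g1 Sg1 Eg1] := schur_step Sg r1 sr1.
have near_step (u v : C -> C) (c : C) :
    (forall z, cmod z < 1 -> (z - r%:C) * v z * (1 - c^* * u z) =
       (1 - (r%:C)^* * z) * (u z - c)) ->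
    near0 (fun h => h * v (r%:C + h) * (1 - c^* * u (r%:C + h)) =
       (1 - (r%:C)^* * (r%:C + h)) * (u (r%:C + h) - c)).
  move=> E; apply: near0W (near_disk r1 E) => h <-.
  by rewrite [_ + h - _]addrAC subrr add0r.
have rg := proj1 Sg _ r1; have rg1 := proj1 Sg1 _ r1.
rewrite gr in Eg1; have nE := near_disk r1 Eg.
have nE1 := near_step _ _ _ Eg1.
have g1r : g1 r%:C = lam.
  have [f0E fS] := tcoef_mulid rg nE; have [_ + _ _] := schur_coefs rg rg1 r1 nE1.
  rewrite /= !tcoef0 // gr subrr mulr0 subr0 => k1E.
  have := fS 0%N; rewrite -derive1_regular; last exact: rf.
  rewrite f'r tcoef0 // gr => /esym/eqP; rewrite [X in _ == X]addrC -subr_eq addrK => /eqP.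
  move: k1E; rewrite !conj_realC; set k1 := tcoef g _ 1 => k1E k1E'.
  have D0 : 1 - rC * rC != 0 by rewrite -expr2; exact: (r1_neq0 hs hsr hr).
  have rc0 : rC != 0 by exact: r_neq0 hs hsr.
  have S0 : 1 - (s / r)%:C * (s / r)%:C != 0 :> C.
    rewrite -rmorphM -(rmorph1 (real_complex R)) -rmorphB -cmod_eq0 cmodR normr_eq0.
    rewrite gt_eqF // subr_gt0 -expr2 -(expr1n _ 2).
    rewrite ltr_sqr ?nnegrE ?(divr_ge0 hs (ltW r_gt0)) //.
    by rewrite ltr_pdivrMr // mul1r.
  apply: (mulIf S0); rewrite -k1E; apply: (mulfI rc0).
  rewrite mulrCA k1E'.
  rewrite !(rmorphM, fmorphV, rmorphB, rmorphXn, rmorph1) /= -/rC.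
  by field; rewrite rc0 D0.
have g1r1 : cmod (g1 r%:C) < 1 by rewrite g1r.
have [g2 Sg2 Eg2] := schur_step Sg1 r1 g1r1; rewrite g1r in Eg2.
have rg2 := proj1 Sg2 _ r1.
have [_ _ f3] := H0_at_coef hs hsr hr hlam rg rg1 rg2 nE nE1 (near_step _ _ _ Eg2).
rewrite derive3_regular_disk // f3.
eexists; last by reflexivity.
exists (g2 r%:C); first exact: (proj2 Sg2).
rewrite [_ + r%:C / _ * _]addrC addrK cmodM -tparE.
have t0 : 0 <= tpar r s lam by rewrite tparE cmod_ge0.
rewrite ler_wpM2l //; have := schwarz_pick_deriv Sg2 r1.
rewrite cmodR ger0_norm ?(ltW r_gt0) // => le1; rewrite cmodM.
rewrite -rmorphXn -(rmorph1 (real_complex R)) -rmorphB cmodR ger0_norm //.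
by rewrite subr_ge0 -(expr1n _ 2) ler_sqr ?nnegrE // ltW.
Qed.

(** Schur's algorithm backwards from the constant [om] that places [w] in its disk. *)
Lemma Vset_attained w : disk_union (eta r s lam) (tpar r s lam) w ->
  Vset r s lam ((coefA r s)%:C * (Defs.coefB r s lam + Defs.coefC r s lam * w)).
Proof.
move=> [zeta z1 hw].
have r_gt0 := r_gt0 hs hsr.
have r1 : cmod (r%:C : C) < 1 by exact: cmod_r hsr hr.
have K0 := eta_den_neq0 hs hsr hlam; have rc0 : (r%:C : C) != 0 := r_neq0 hs hsr.
pose tau : C := r%:C / eta_den r s lam.
have tau0 : tau != 0 by rewrite mulf_neq0 // invr_eq0.
pose u := w - zeta * (1 - eta r s lam * zeta).
pose v := tau * (1 - cmod zeta ^+ 2)%:C.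
have z2 : 0 <= 1 - cmod zeta ^+ 2.
  by rewrite subr_ge0 -(expr1n _ 2) ler_sqr ?nnegrE ?cmod_ge0.
have [om om1 uE] : exists2 om : C, cmod om <= 1 & u = v * om.
  have uv : cmod u <= cmod v.
    by rewrite /v cmodM (cmod_real z2) /tau -tparE.
  have [v0|v0] := eqVneq v 0.
    exists 0; rewrite ?cmod0 // mulr0; apply/eqP; rewrite -cmod_eq0.
    by rewrite eq_le cmod_ge0 andbT; move: uv; rewrite v0 cmod0.
  exists (u / v); last by rewrite mulrC divfK.
  by rewrite cmodM cmodV ler_pdivrMr ?cmod_gt0 // mul1r.
have sr1 : cmod ((s / r)%:C : C) < 1.
  by rewrite cmod_real ?divr_ge0 // ?ltr_pdivrMr ?mul1r // ltW.
pose F3 : {poly C} * {poly C} := (om%:P, 1).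
have S3 : schur_frac F3.
  by move=> z _; rewrite /F3 /= !hornerE cmod1 oner_neq0.
pose F2 := unschur r%:C zeta F3; pose F1 := unschur r%:C lam F2.
pose F0 := unschur r%:C (s / r)%:C F1.
have S2 : schur_frac F2 by exact: unschur_frac.
have S1 : schur_frac F1 by apply: unschur_frac => //; exact: ltW.
have S0 : schur_frac F0 by apply: unschur_frac => //; exact: ltW.
pose f z := ('X * F0.1).[z] / F0.2.[z].
have fE z : f z = z * frac F0 z by rewrite /f hornerM hornerX mulrA.
have af : analytic_on unit_disk f.
  by apply: rational_analytic => z /unit_diskE/S0[].
have rf : regular_disk f by move=> z z1'; apply: (analytic_regular af); exact/unit_diskE.
have near_step F c (c1 : cmod c <= 1) (SF : schur_frac F) :
    near0 (fun h => h * frac F (r%:C + h) * (1 - c^* * frac (unschur r%:C c F) (r%:C + h)) =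
       (1 - (r%:C)^* * (r%:C + h)) * (frac (unschur r%:C c F) (r%:C + h) - c)).
  apply: near0W (near_disk r1 (fun z hz => unschur_rel r1 c1 SF hz)) => h <-.
  by rewrite [_ + h - _]addrAC subrr add0r.
have reg F (SF : schur_frac F) : regular (frac F) r%:C by exact: regular_frac.
have nE : near0 (fun h => f (r%:C + h) = (r%:C + h) * frac F0 (r%:C + h)).
  by exists 1 => // h _; rewrite fE.
have [f0 f1 f3] := H0_at_coef hs hsr hr hlam (reg _ S0) (reg _ S1) (reg _ S2) nE
  (near_step _ _ (ltW sr1) S1) (near_step _ _ (ltW hlam) S2).
exists f; first split.
- split=> // [z /unit_diskE z1'|]; last by rewrite fE mul0r.
  apply/unit_diskE; rewrite fE cmodM.
  have [D0 ND] := S0 z z1'; apply: le_lt_trans z1'.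
  by rewrite ler_piMr ?cmod_ge0 // cmodM cmodV ler_pdivrMr ?cmod_gt0 // mul1r.
- by rewrite -f0 tcoef0 //; exact: rf.
- by rewrite derive1_regular //; exact: rf.
rewrite derive3_regular_disk // f3 /F2 unschur_val //.
have [_ + _ _] := schur_coefs (reg _ S2) (reg _ S3) r1 (near_step _ _ z1 S3).
rewrite /= tcoef0; last exact: reg.
rewrite tcoef0; last exact: reg.
rewrite unschur_val // subrr mulr0 subr0 conj_realC -expr2 => ->.
have -> : frac F3 r%:C = om by rewrite /frac /F3 /= !hornerE divr1.
congr (_ * (_ + _ * _)); rewrite /cfun.
have -> : w = zeta * (1 - eta r s lam * zeta) + v * om by rewrite -uE /u addrC subrK.
by congr (_ + _); rewrite /v /tau rmorphB /= cmod_sqrC rmorph1; ring.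
Qed.

Lemma Vset_disk_union : Vset r s lam =
  (fun w => (coefA r s)%:C * (Defs.coefB r s lam + Defs.coefC r s lam * w)) @`
    disk_union (eta r s lam) (tpar r s lam).
Proof.
apply/seteqP; split=> [_ [f /Vset_values[w hw ->] <-]|_ [w hw <-]]; first by exists w.
exact: Vset_attained.
Qed.

End Body.

(** * Convex geometry of the union of disks *)

Section Convex.
Variable R : realType.
Local Notation C := (CC R).
Implicit Types (x y b z w h c p q u d zeta : C).

Definition dot u p : R := complex.Re (u^* * p).

Lemma dotDr u p q : dot u (p + q) = dot u p + dot u q.
Proof. by rewrite /dot mulrDr; case: (_ * p) => ? ?; case: (_ * q). Qed.

Lemma dotNr u p : dot u (- p) = - dot u p.
Proof. by rewrite /dot mulrN; case: (_ * p). Qed.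

Lemma dot_le u p : cmod u = 1 -> dot u p <= cmod p.
Proof.
by move=> u1; apply: (le_trans (Re_le_cmod _)); rewrite cmodM cmodJ u1 mul1r.
Qed.

Lemma cmodDsqr p q : cmod (p + q) ^+ 2 = cmod p ^+ 2 + 2 * dot p q + cmod q ^+ 2.
Proof.
rewrite !cmod_sqr /dot conjE !expr2.
by case: p => a b; case: q => a' b'; simpc => /=; ring.
Qed.

Lemma dotZr u p (k : R) : dot u (k%:C * p) = k * dot u p.
Proof.
by rewrite /dot conjE; case: u => a b; case: p => a' b'; simpc => /=; ring.
Qed.

Lemma dotZl u p (k : R) : dot (k%:C * u) p = k * dot u p.
Proof.
by rewrite /dot conjE; case: u => a b; case: p => a' b'; simpc => /=; ring.
Qed.

Lemma dotii u : dot u u = cmod u ^+ 2.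
Proof.
by rewrite cmod_sqr /dot conjE !expr2; case: u => a b; simpc => /=; ring.
Qed.

Variables (e : C) (t : R).
Hypothesis (et : cmod e < t).

Local Notation W := (disk_union e t).
Definition center z := z * (1 - e * z).

Lemma radius_gt0 : 0 < t. Proof. exact: le_lt_trans (cmod_ge0 e) et. Qed.

(** The set is a continuous image of the product of two closed unit disks. *)
Lemma disk_union_closed : closed W.
Proof.
apply: compact_closed; first exact: norm_hausdorff.
have -> : W = (fun v : C * C => center v.1 + t%:C * (1 - (cmod v.1)%:C ^+ 2) * v.2) @`
    (cdisk 0 1 `*` cdisk 0 1).
  have sq z : 1 - (cmod z)%:C ^+ 2 = (1 - cmod z ^+ 2)%:C :> C.
    by rewrite rmorphB /= rmorphXn.
  have z2 z : cmod z <= 1 -> 0 <= 1 - cmod z ^+ 2.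
    by move=> z1; rewrite subr_ge0 -(expr1n _ 2) ler_sqr ?nnegrE ?cmod_ge0.
  apply/seteqP; split=> [p [z z1 hp]|_ [[z w] /= [+ +] <-]].
    pose rho := t * (1 - cmod z ^+ 2).
    have rho0 : 0 <= rho by rewrite mulr_ge0 ?z2 // ltW // radius_gt0.
    have [rho00|rho_neq0] := eqVneq rho 0.
      exists (z, 0); rewrite /cdisk /= ?subr0 ?cmod0 //.
      apply/eqP; rewrite mulr0 addr0 eq_sym -subr_eq0 -cmod_eq0 eq_le cmod_ge0 andbT.
      by move: hp; rewrite -/rho rho00.
    exists (z, (p - center z) / rho%:C); rewrite /cdisk /= ?subr0.
      split=> //; rewrite cmodM cmodV cmod_real // ler_pdivrMr ?mul1r //.
      by rewrite lt_def rho_neq0.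
    have -> : t%:C * (1 - (cmod z)%:C ^+ 2) = rho%:C by rewrite sq /rho rmorphM.
    have rhoC : rho%:C != 0 :> C by rewrite -cmod_eq0 cmod_real.
    by field.
  rewrite /cdisk /= !subr0 => z1 w1; exists z => //.
  rewrite -/(center z) [center z + _]addrC addrK !cmodM sq.
  rewrite (cmod_real (z2 _ z1)) (cmod_real (ltW radius_gt0)).
  by rewrite ler_piMr // mulr_ge0 ?z2 // ltW // radius_gt0.
apply: continuous_compact; last by apply: compact_setX; exact: compact_cdisk.
apply: continuous_subspaceT => v.
have c1 : {for v, continuous (fun v : C * C => v.1)} by exact: cvg_fst.
have c2 : {for v, continuous (fun v : C * C => v.2)} by exact: cvg_snd.
have cm : {for v, continuous (fun v : C * C => (cmod v.1)%:C : C)}.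
  apply: (@continuous_comp _ _ _ (fun v : C * C => cmod v.1) (fun y : R => y%:C : C)).
    exact: (continuous_comp c1 (@continuous_cmod R v.1)).
  exact: (@continuous_realC R (cmod v.1)).
have cc (k : C) : {for v, continuous (fun v : C * C => k)} by exact: cst_continuous.
have cm2 := continuousB (cc 1) (continuousM cm cm).
have c3 := continuousM (continuousM (cc t%:C) cm2) c2.
have c4 := continuousM c1 (continuousB (cc 1) (continuousM (cc e) c1)).
exact: (continuousD c4 c3).
Qed.

(** The deviation of [center] from affinity, |e| k(1-k)|z1 - z2|^2, is absorbed by
    the concavity of the radius because |e| < t. *)
Lemma disk_union_convex p q (k : R) : 0 <= k <= 1 -> W p -> W q ->
  W ((1 - k)%:C * p + k%:C * q).
Proof.
move=> /andP[k0 k1] [z1 hz1 hp] [z2 hz2 hq].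
pose z := (1 - k)%:C * z1 + k%:C * z2; pose kk := k * (1 - k).
have kk0 : 0 <= kk by rewrite mulr_ge0 // subr_ge0.
have k10 : 0 <= 1 - k by rewrite subr_ge0.
have zz : cmod z ^+ 2 = (1 - k) * cmod z1 ^+ 2 + k * cmod z2 ^+ 2 - kk * cmod (z1 - z2) ^+ 2.
  rewrite /z /kk !cmod_sqr !expr2; case: (z1) => a b; case: (z2) => a' b'.
  by simpc => /=; ring.
have sq (w : C) : cmod w <= 1 -> cmod w ^+ 2 <= 1.
  by move=> w1; rewrite -(expr1n _ 2) ler_sqr ?nnegrE ?cmod_ge0.
exists z.
  apply: (le_trans (cmodD _ _)); rewrite !cmodM !cmod_real //; nra.
have -> : (1 - k)%:C * p + k%:C * q - z * (1 - e * z) =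
    (1 - k)%:C * (p - center z1) + k%:C * (q - center z2) - e * kk%:C * (z1 - z2) ^+ 2.
  by rewrite /z /kk /center !(rmorphM, rmorphB, rmorph1); ring.
apply: (le_trans (cmodB _ _)); apply: (le_trans (lerD (cmodD _ _) (lexx _))).
rewrite cmodM cmodX !cmodM !cmod_real // zz.
have h1 : (1 - k) * cmod (p - center z1) <= (1 - k) * (t * (1 - cmod z1 ^+ 2)).
  by rewrite ler_wpM2l.
have h2 : k * cmod (q - center z2) <= k * (t * (1 - cmod z2 ^+ 2)).
  by rewrite ler_wpM2l.
have h3 : cmod e * (kk * cmod (z1 - z2) ^+ 2) <= t * (kk * cmod (z1 - z2) ^+ 2).
  by rewrite ler_wpM2r ?(ltW et) // mulr_ge0 // sqr_ge0.
rewrite -[cmod e * kk * _]mulrA; move: h1 h2 h3; set D := kk * _; lra.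
Qed.

(** The function z |-> Re (u^* center z) - x |z|^2 is quadratic with second order
    part -(x |d|^2 + Re (u^* e d^2)), strictly concave for x > |e|; at a critical
    point [zeta] its linear part vanishes. *)
Lemma support_gap u zeta z (x : R) : u * (1 - 2 * e^* * zeta^*) = 2 * x%:C * zeta ->
  cmod u = 1 ->
  dot u (center z) - x * cmod z ^+ 2 + (x - cmod e) * cmod (z - zeta) ^+ 2 <=
  dot u (center zeta) - x * cmod zeta ^+ 2.
Proof.
move=> st u1; pose d := z - zeta.
have H : dot u (center z) - x * cmod z ^+ 2 = dot u (center zeta) - x * cmod zeta ^+ 2
   + dot (u * (1 - 2 * e^* * zeta^*) - 2 * x%:C * zeta) d
   - x * cmod d ^+ 2 - dot u (e * d ^+ 2).
  rewrite /d /center /dot !cmod_sqr conjE !expr2 !conjE.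
  case: (u) => u1' u2; case: (e) => e1 e2; case: (z) => a b; case: (zeta) => a' b'.
  by simpc => /=; ring.
have : - dot u (e * d ^+ 2) <= cmod e * cmod d ^+ 2.
  by rewrite -dotNr; apply: (le_trans (dot_le _ u1)); rewrite cmodN cmodM cmodX.
rewrite H st subrr /d; have -> : dot 0 (z - zeta) = 0 by rewrite /dot conjC0 mul0r.
lra.
Qed.

(** The critical point of z |-> Re (u^* center z) - x |z|^2. *)
Definition critical u (x : R) : C :=
  (x%:C * u - e^*) / (2 * (x ^+ 2 - cmod e ^+ 2))%:C.

Lemma sqr_gap_gt0 (x : R) : cmod e < x -> 0 < x ^+ 2 - cmod e ^+ 2.
Proof.
move=> ex; rewrite subr_gt0 ltr_sqr ?nnegrE ?cmod_ge0 //.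
by rewrite ltW // (le_lt_trans _ ex) // cmod_ge0.
Qed.

Lemma unit_mulJ u : cmod u = 1 -> u * u^* = 1.
Proof. by move=> u1; rewrite -cmod_sqrC u1 expr1n. Qed.

Lemma critical_stat u (x : R) : cmod u = 1 -> cmod e < x ->
  u * (1 - 2 * e^* * (critical u x)^*) = 2 * x%:C * critical u x.
Proof.
move=> u1 ex; have d0 := sqr_gap_gt0 ex.
have dE : (2 * (x ^+ 2 - cmod e ^+ 2))%:C = 2 * (x%:C ^+ 2 - e * e^*) :> C.
  by rewrite rmorphM rmorphB /= !cmod_sqrC rmorphXn rmorph_nat.
have dC : x%:C ^+ 2 - e * e^* != 0 :> C.
  by rewrite -cmod_sqrC -rmorphXn -rmorphB -cmod_eq0 cmodR normr_eq0 gt_eqF.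
rewrite /critical dE rmorphM rmorphB rmorphM /= conjCK conj_realC fmorphV /=.
rewrite rmorphM rmorphB rmorphXn rmorphM /= conj_realC conjCK conjC_nat.
have := unit_mulJ u1; have u0 : u != 0 by rewrite -cmod_gt0 u1.
move=> uJ; have -> : u^* = u^-1 by apply: (mulfI u0); rewrite uJ divff.
move: dC; rewrite [e^* * e]mulrC => dC.
by field; rewrite dC u0.
Qed.

Lemma stat_critical u zeta (x : R) : cmod u = 1 -> cmod e < x ->
  u * (1 - 2 * e^* * zeta^*) = 2 * x%:C * zeta -> zeta = critical u x.
Proof.
move=> u1 ex st.
have cz := critical_stat u1 ex; have := support_gap (critical u x) st u1.
have := support_gap zeta cz u1; rewrite [cmod (zeta - _)]cmodBC.
set D := cmod (critical u x - zeta) => h1 h2; apply/eqP.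
rewrite eq_sym -subr_eq0 -cmod_eq0 -/D.
have x0 : 0 < x - cmod e by rewrite subr_gt0.
have : (x - cmod e) * D ^+ 2 <= 0 by lra.
by rewrite pmulr_rle0 // real_exprn_even_le0 ?num_real.
Qed.

Definition extremal u zeta : C := center zeta + (t * (1 - cmod zeta ^+ 2))%:C * u.

Lemma sqr_le1 z : cmod z <= 1 -> 0 <= 1 - cmod z ^+ 2.
Proof.
by move=> z1; rewrite subr_ge0 -(expr1n _ 2) ler_sqr ?nnegrE ?cmod_ge0.
Qed.

Lemma radius_ge0 z : cmod z <= 1 -> 0 <= t * (1 - cmod z ^+ 2).
Proof. by move=> z1; rewrite mulr_ge0 ?sqr_le1 // ltW // radius_gt0. Qed.

Lemma extremal_in u zeta : cmod u = 1 -> cmod zeta <= 1 -> W (extremal u zeta).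
Proof.
move=> u1 z1; exists zeta => //.
by rewrite /extremal addrC addKr cmodM u1 mulr1 cmod_real // radius_ge0.
Qed.

Lemma dot_extremal u zeta : cmod u = 1 ->
  dot u (extremal u zeta) = dot u (center zeta) + t * (1 - cmod zeta ^+ 2).
Proof. by move=> u1; rewrite dotDr dotZr dotii u1 expr1n mulr1. Qed.

(** Here [x] is [t], or the Lagrange multiplier of the constraint |z| = 1; in both
    cases replacing t (1 - |z|^2) by x (1 - |z|^2) loses nothing at the critical
    point and only increases the function elsewhere in the disk. *)
Lemma extremal_support u (x : R) z q : cmod u = 1 -> t <= x ->
  cmod (critical u x) <= 1 -> (x == t) || (cmod (critical u x) == 1) ->
  cmod z <= 1 -> cmod (q - center z) <= t * (1 - cmod z ^+ 2) ->
  dot u q + (x - cmod e) * cmod (z - critical u x) ^+ 2 <=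
  dot u (extremal u (critical u x)).
Proof.
move=> u1 tx c1 xt z1 hq; have ex : cmod e < x by exact: lt_le_trans tx.
have gap := support_gap z (critical_stat u1 ex) u1.
have hq' : dot u q <= dot u (center z) + t * (1 - cmod z ^+ 2).
  have -> : q = center z + (q - center z) by rewrite addrC subrK.
  by rewrite dotDr lerD2l; apply: le_trans hq; exact: dot_le.
have hx : t * (1 - cmod z ^+ 2) <= x * (1 - cmod z ^+ 2).
  by rewrite ler_wpM2r ?sqr_le1.
rewrite dot_extremal //.
have -> : t * (1 - cmod (critical u x) ^+ 2) = x * (1 - cmod (critical u x) ^+ 2).
  by case/orP: xt => /eqP ->; rewrite // expr1n subrr !mulr0.
by move: gap hq' hx; rewrite !mulrBr !mulr1; lra.
Qed.

Lemma interior_disk p z : cmod z <= 1 ->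
  cmod (p - center z) < t * (1 - cmod z ^+ 2) -> interior W p.
Proof.
move=> z1 hp; apply/nbhs_cmod; exists (t * (1 - cmod z ^+ 2) - cmod (p - center z)).
  by rewrite subr_gt0.
move=> w hw; exists z => //; have -> : w - z * (1 - e * z) = (w - p) + (p - center z).
  by rewrite /center; ring.
by apply: (le_trans (cmodD _ _)); lra.
Qed.

(** A boundary point of a disk contained in the convex set [W] is interior to [W]
    as soon as [W] has a point strictly beyond the tangent line. *)
Lemma interior_beyond u z q : cmod u = 1 -> cmod z < 1 -> W q ->
  dot u (extremal u z) < dot u q -> interior W (extremal u z).
Proof.
move=> u1 z1 Wq; set p := extremal u z => pq; set rho := t * (1 - cmod z ^+ 2).
have rho0 : 0 < rho.
  by rewrite mulr_gt0 ?radius_gt0 // subr_gt0 -(expr1n _ 2) ltr_sqr ?nnegrE ?cmod_ge0.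
pose d := q - p; have du : 0 < dot u d by rewrite dotDr dotNr subr_gt0.
have d2 : 0 <= cmod d ^+ 2 by exact: sqr_ge0.
(* Small enough for the move of -k d from p, which points into the disk, to stay
   inside it. *)
pose k := rho * dot u d / (cmod d ^+ 2 + 1).
have d21 : 0 < cmod d ^+ 2 + 1 by rewrite ltr_wpDl.
have k0 : 0 < k by rewrite divr_gt0 // mulr_gt0.
have kd : k * cmod d ^+ 2 < 2 * rho * dot u d.
  have -> : 2 * rho * dot u d = 2 * (k * (cmod d ^+ 2 + 1)).
    by rewrite /k divfK ?mulrA // gt_eqF.
  have : 0 <= k * cmod d ^+ 2 by rewrite mulr_ge0 // ltW.
  lra.
pose y := p - k%:C * d.
have ylt : cmod (y - center z) < rho.
  rewrite -ltr_sqr ?nnegrE ?cmod_ge0 ?(ltW rho0) //.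
  have -> : y - center z = rho%:C * u + - (k%:C * d).
    by rewrite /y /p /extremal -/rho; ring.
  rewrite cmodDsqr dotNr dotZr dotZl cmodN !cmodM u1 mulr1 !cmod_real ?ltW //.
  rewrite exprMn; have : k * (k * cmod d ^+ 2) < k * (2 * rho * dot u d).
    by rewrite ltr_pM2l.
  by rewrite expr2; lra.
apply/nbhs_cmod; exists ((rho - cmod (y - center z)) / (1 + k)).
  by rewrite divr_gt0 ?subr_gt0 // addr_gt0.
move=> w; rewrite ltr_pdivlMr ?addr_gt0 // => hw.
pose y' := (1 + k)%:C * w - k%:C * q.
have k1 : 0 < 1 + k by rewrite addr_gt0.
have k1C : (1 + k)%:C != 0 :> C by rewrite -cmod_eq0 cmodR normr_eq0 gt_eqF.
have Wy : W y'.
  exists z; first exact: ltW.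
  have -> : y' - z * (1 - e * z) = (1 + k)%:C * (w - p) + (y - center z).
    by rewrite /y' /y /d rmorphD rmorph1 /center; ring.
  apply: (le_trans (cmodD _ _)); rewrite cmodM cmod_real ?(ltW k1) // -/rho.
  by rewrite mulrC; lra.
have kk : 0 <= k / (1 + k) <= 1.
  by rewrite divr_ge0 ?(ltW k0) ?(ltW k1) //= ler_pdivrMr // mul1r lerDr.
have := disk_union_convex kk Wy Wq.
have -> : (1 - k / (1 + k))%:C = (1 + k)%:C^-1 :> C.
  by rewrite -fmorphV; congr (_%:C); field; rewrite gt_eqF.
rewrite rmorphM fmorphV; suff -> : (1 + k)%:C^-1 * y' + k%:C / (1 + k)%:C * q = w by [].
by rewrite /y'; field; move: k1C; rewrite rmorphD rmorph1.
Qed.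

(** Moving the parameter inwards by k, the center moves by about k |1 - 2 e z| and
    the radius grows by about 2 k t. *)
Lemma interior_radial z : cmod z = 1 -> cmod (1 - 2 * e * z) < 2 * t ->
  interior W (center z).
Proof.
move=> z1; set g := cmod _ => gt; have t0 := radius_gt0; have e0 := cmod_ge0 e.
have g0 : 0 <= g by exact: cmod_ge0.
have et0 : 0 < cmod e + t by rewrite ltr_wpDl.
(* Half the value at which the second order terms k^2 (|e| + t) take over. *)
pose k := (2 * t - g) / (2 * (cmod e + t)).
have kE : k * (cmod e + t) = (2 * t - g) / 2.
  by rewrite /k; field; rewrite gt_eqF.
have k0 : 0 < k by rewrite divr_gt0 ?subr_gt0 ?mulr_gt0.
have k1 : k <= 1 by rewrite ler_pdivrMr ?mulr_gt0 //; lra.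
have zk : cmod ((1 - k)%:C * z) = 1 - k by rewrite cmodM z1 mulr1 cmod_real // subr_ge0.
apply: (@interior_disk _ ((1 - k)%:C * z)); first by rewrite zk; lra.
have -> : center z - center ((1 - k)%:C * z) =
    k%:C * (z * (1 - 2 * e * z)) + k%:C ^+ 2 * (e * z ^+ 2).
  by rewrite /center rmorphB rmorph1; ring.
rewrite zk; apply: (le_lt_trans (cmodD _ _)).
rewrite [cmod (k%:C ^+ 2 * _)]cmodM !cmodX [cmod (e * _)]cmodM cmodX z1 expr1n mulr1.
rewrite !cmodM z1 mul1r cmod_real ?(ltW k0) // -/g.
have : k * (k * (cmod e + t)) < k * (2 * t - g).
  by rewrite ltr_pM2l // kE; lra.
by rewrite expr2; lra.
Qed.

Lemma critical_cmod u (x : R) : cmod e < x ->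
  cmod (critical u x) * (2 * (x ^+ 2 - cmod e ^+ 2)) = cmod (x%:C * u - e^*).
Proof.
move=> ex; have d0 := sqr_gap_gt0 ex.
rewrite cmodM cmodV cmod_real ?divfK //; last by rewrite ltW // mulr_gt0.
by rewrite gt_eqF // mulr_gt0.
Qed.

(** By continuity the multiplier can be increased from [t] until the critical
    point reaches the unit circle. *)
Lemma critical_on_circle u : cmod u = 1 -> 1 <= cmod (critical u t) ->
  exists2 x, t <= x & cmod (critical u x) = 1.
Proof.
move=> u1 h1; have e0 := cmod_ge0 e; have t0 := radius_gt0.
pose F (x : R) := cmod (x%:C * u - e^*) - 2 * (x ^+ 2 - cmod e ^+ 2).
(* |x u - e^*| <= x + |e| <= 2 (x^2 - |e|^2) as soon as x >= |e| + 1/2. *)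
have cF : {within `[t, t + cmod e + 1 / 2], continuous F}.
  apply: continuous_subspaceT => x.
  have c1 : {for x, continuous (fun y : R => y%:C : C)} by exact: continuous_realC.
  have cu (k : C) : {for x, continuous (fun y : R => k)} by exact: cst_continuous.
  have cr (k : R) : {for x, continuous (fun y : R => k)} by exact: cst_continuous.
  have ci : {for x, continuous (fun y : R => y)} by exact: cvg_id.
  have c2 := continuousB (continuousM c1 (cu u)) (cu e^*).
  have c3 := continuous_comp c2 (@continuous_cmod R _).
  exact: (continuousB c3 (continuousM (cr 2)
    (continuousB (continuousM ci ci) (cr (cmod e ^+ 2))))).
have [||x] := @IVT R F t (t + cmod e + 1 / 2) 0 _ cF.
- lra.
- rewrite ge_min le_max; apply/andP; split; apply/orP; [right|left].
    rewrite /F subr_le0; apply: (le_trans (cmodB _ _)).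
    rewrite cmodM u1 mulr1 cmodJ cmod_real; last lra.
    by nra.
  by rewrite /F subr_ge0 -critical_cmod // ler_peMl // ltW // mulr_gt0 // sqr_gap_gt0.
rewrite in_itv /= => /andP[tx _] Fx; exists x => //.
have ex : cmod e < x by exact: lt_le_trans tx.
have d0 := sqr_gap_gt0 ex.
apply: (@mulIf _ (2 * (x ^+ 2 - cmod e ^+ 2))); first by rewrite gt_eqF // mulr_gt0.
by rewrite critical_cmod // mul1r; move/eqP: Fx; rewrite subr_eq0 => /eqP.
Qed.

End Convex.

(** * The boundary of the union of disks *)

Section Frontier.
Variable R : realType.
Local Notation C := (CC R).
Implicit Types (z w p q u zeta : C).

Lemma nbhs_affine (a b : C) p (P : set C) : a != 0 ->
  nbhs (a * p + b) P -> nbhs p [set w | P (a * w + b)].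
Proof.
move=> a0 /nbhs_cmod[d d0 hd]; apply/nbhs_cmod.
have ca : 0 < cmod a by rewrite cmod_gt0.
exists (d / cmod a); first by rewrite divr_gt0.
move=> w; rewrite ltr_pdivlMr // => hw; apply: hd.
by have -> : a * w + b - (a * p + b) = (w - p) * a; [ring|rewrite cmodM].
Qed.

Lemma frontier_affine (a b : C) (X : set C) : a != 0 ->
  frontier ((fun w => a * w + b) @` X) = (fun w => a * w + b) @` frontier X.
Proof.
move=> a0; set g := fun w : C => a * w + b.
pose h w := a^-1 * w + (- a^-1 * b).
have gh w : g (h w) = w by rewrite /g /h; field.
have hg w : h (g w) = w by rewrite /g /h; field.
have a0' : a^-1 != 0 by rewrite invr_eq0.
have clg p : closure (g @` X) (g p) <-> closure X p.
  split=> cl B nB.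
    have nB' : nbhs (g p) [set w | B (h w)].
      by apply: (nbhs_affine (b := - a^-1 * b) a0'); rewrite -/(h (g p)) hg.
    have [_ [[w Xw <-] Bw]] := cl _ nB'; exists w; split=> //.
    by move: Bw; rewrite /= hg.
  have [w [Xw Bw]] := cl _ (nbhs_affine a0 nB).
  by exists (g w); split=> //; exists w.
have ing p : interior (g @` X) (g p) <-> interior X p.
  split=> ni.
    have := nbhs_affine a0 ni; apply: filterS => w [w' Xw' /(congr1 h)].
    by rewrite hg -/(g w) hg => <-.
  have : nbhs (g p) [set w | X (h w)].
    by apply: (nbhs_affine (b := - a^-1 * b) a0'); rewrite -/(h (g p)) hg.
  by apply: filterS => w Xw; exists (h w).
apply/seteqP; split=> [p [cl ni]|_ [p [cl ni] <-]].
  exists (h p); last exact: gh.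
  by split; [apply/clg|move/ing]; rewrite gh.
by split; [apply/clg|move/ing].
Qed.

Variables (e : C) (t : R).
Hypothesis (et : cmod e < t).

Local Notation W := (disk_union e t).
Local Notation crit u := (critical e u t).
Local Notation center := (center e).

(** The points of the unit circle where the curve [center] has speed at least 2t,
    the rate at which the radii grow inwards: no disk of the family covers it. *)
Definition outer : set C := [set z | cmod z = 1 /\ 2 * t <= cmod (1 - 2 * e * z)].

Lemma support_not_interior u p : cmod u = 1 -> (forall q, W q -> dot u q <= dot u p) ->
  ~ interior W p.
Proof.
move=> u1 sup /nbhs_cmod[d d0 hd].
have /sup : W (p + (d / 2)%:C * u).
  by apply: hd; rewrite [p + _]addrC addrK cmodM u1 mulr1 cmod_real; lra.
by rewrite dotDr dotZr dotii u1 expr1n; lra.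
Qed.

(** The direction is the normal of the curve [center] at [z], and the multiplier is
    half its speed. *)
Lemma outer_critical z : outer z ->
  exists u x, [/\ cmod u = 1, t <= x & z = critical e u x].
Proof.
move=> [z1 zt]; pose x := cmod (1 - 2 * e * z) / 2.
have tx : t <= x by rewrite /x; lra.
have t0 : 0 < t := radius_gt0 et.
have x0 : 0 < x by lra.
have cx : cmod (1 - 2 * e * z) = 2 * x by rewrite /x; lra.
have nz : 1 - 2 * e * z != 0 by rewrite -cmod_gt0 cx; lra.
exists (z * (1 - 2 * e * z) / (2 * x)%:C), x.
have u1 : cmod (z * (1 - 2 * e * z) / (2 * x)%:C) = 1.
  by rewrite !cmodM cmodV z1 cx mul1r cmod_real ?divff //; lra.
split=> //; apply: stat_critical => //; first exact: lt_le_trans tx.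
have -> : 1 - 2 * e^* * z^* = (1 - 2 * e * z)^*.
  by rewrite rmorphB rmorph1 !rmorphM /= conjC_nat.
have xC : (2 * x)%:C = 2 * x%:C :> C by rewrite rmorphM rmorph_nat.
have xC0 : x%:C != 0 :> C by rewrite -cmod_eq0 cmodR normr_eq0 gt_eqF.
transitivity (z * ((1 - 2 * e * z) * (1 - 2 * e * z)^*) / (2 * x)%:C); first by ring.
by rewrite -cmod_sqrC cx xC rmorphXn rmorphM rmorph_nat; field.
Qed.

Lemma extremal_unit u zeta : cmod zeta = 1 -> extremal e t u zeta = center zeta.
Proof. by move=> z1; rewrite /extremal z1 expr1n subrr mulr0 mul0r addr0. Qed.

(** Let p be a boundary point, in the disk with parameter z. If |z| = 1, then z is
    [outer] by [interior_radial]. If |z| < 1, then p is on the boundary of the disk,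
    whose tangent at p supports the whole set by [interior_beyond], and strict
    concavity identifies z with the maximizer in the normal direction. *)
Theorem frontier_disk_union :
  frontier W = [set center z | z in outer] `|`
    [set extremal e t u (crit u) | u in [set u | cmod u = 1 /\ cmod (crit u) < 1]].
Proof.
apply/seteqP; split=> [p [cl ni]|p].
  have [z z1 hz] : W p by move: cl; exact: disk_union_closed.
  have [zlt|] := ltP (cmod z) 1; last first.
    move=> z1'; have {z1 z1'}z1 : cmod z = 1 by apply/eqP; rewrite eq_le z1.
    have pz : p = center z.
      apply/eqP; rewrite -subr_eq0 -cmod_eq0 eq_le cmod_ge0 andbT.
      by apply: (le_trans hz); rewrite z1 expr1n subrr mulr0.
    left; exists z => //; split=> //; rewrite leNgt; apply/negP => lt.
    by apply: ni; rewrite pz; exact: interior_radial.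
  have rho0 : 0 < t * (1 - cmod z ^+ 2).
    rewrite mulr_gt0 ?(radius_gt0 et) // subr_gt0 -(expr1n _ 2).
    by rewrite ltr_sqr ?nnegrE ?cmod_ge0.
  set rho := t * _ in rho0 hz.
  have hz' : cmod (p - center z) = rho.
    apply/eqP; rewrite eq_le hz /= leNgt; apply/negP => lt.
    by apply: ni; exact: interior_disk lt.
  have rhoC : rho%:C != 0 :> C by rewrite -cmod_eq0 cmodR normr_eq0 gt_eqF.
  pose u := (p - center z) / rho%:C.
  have u1 : cmod u = 1 by rewrite cmodM cmodV hz' cmod_real ?divff ?gt_eqF // ltW.
  have pE : p = extremal e t u z by rewrite /extremal -/rho /u; field.
  have sup q : W q -> dot u q <= dot u p.
    move=> Wq; rewrite leNgt; apply/negP => lt; apply: ni.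
    rewrite pE; apply: (interior_beyond et u1 zlt Wq); rewrite -pE; exact: lt.
  have key x : t <= x -> cmod (critical e u x) <= 1 ->
      (x == t) || (cmod (critical e u x) == 1) -> z = critical e u x.
    move=> tx c1 xt.
    have := extremal_support et u1 tx c1 xt z1 hz.
    have := sup _ (extremal_in et u1 c1).
    set D := cmod (z - critical e u x) => h1 h2.
    apply/eqP; rewrite -subr_eq0 -cmod_eq0 -/D.
    have x0 : 0 < x - cmod e by rewrite subr_gt0 (lt_le_trans et).
    have : (x - cmod e) * D ^+ 2 <= 0 by lra.
    by rewrite pmulr_rle0 // real_exprn_even_le0 ?num_real.
  have [c1|c1] := ltP (cmod (crit u)) 1.
    right; exists u => //=; rewrite pE; congr (extremal e t u _).
    by apply/esym; apply: key => //; rewrite ?eqxx // ltW.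
  have [x tx cx] := critical_on_circle et u1 c1.
  have zx : z = critical e u x by apply: key; rewrite ?cx ?eqxx ?orbT.
  by move: zlt; rewrite zx cx ltxx.
have ok u x : cmod u = 1 -> t <= x -> cmod (critical e u x) <= 1 ->
    (x == t) || (cmod (critical e u x) == 1) ->
    frontier W (extremal e t u (critical e u x)).
  move=> u1 tx c1 xt; split; first by apply: subset_closure; exact: extremal_in.
  apply: (support_not_interior u1) => q [z z1 hz].
  have := extremal_support et u1 tx c1 xt z1 hz.
  have : 0 <= (x - cmod e) * cmod (z - critical e u x) ^+ 2.
    by rewrite mulr_ge0 ?sqr_ge0 // subr_ge0 ltW // (lt_le_trans et).
  lra.
move=> [[z Jz <-]|[u [u1 c1] <-]]; last by apply: ok; rewrite ?eqxx // ltW.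
have [u [x [u1 tx zE]]] := outer_critical Jz; have [z1 _] := Jz.
by rewrite -(extremal_unit u z1) zE; apply: ok => //; rewrite -zE z1 ?eqxx ?orbT.
Qed.

(** The critical point is an affine function of [u], and the quadratic terms of the
    center and of the radius recombine because u u^* = 1. *)
Lemma extremal_circle u : cmod u = 1 ->
  extremal e t u (crit u) =
  ((1 + 4 * (t ^+ 2 - cmod e ^+ 2)) * t)%:C * u / (4 * (t ^+ 2 - cmod e ^+ 2))%:C
  - e^* / (4 * (t ^+ 2 - cmod e ^+ 2))%:C.
Proof.
move=> u1; have d0 := sqr_gap_gt0 et.
have dE : (t ^+ 2 - cmod e ^+ 2)%:C = t%:C ^+ 2 - e * e^* :> C.
  by rewrite rmorphB /= !cmod_sqrC rmorphXn.
have dC : t%:C ^+ 2 - e^* * e != 0 :> C.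
  by rewrite mulrC -dE -cmod_eq0 cmodR normr_eq0 gt_eqF.
have uJ := unit_mulJ u1; have u0 : u != 0 by rewrite -cmod_gt0 u1.
have uV : u^* = u^-1 by apply: (mulfI u0); rewrite uJ divff.
have cE : crit u = (t%:C * u - e^*) / (2 * (t%:C ^+ 2 - e^* * e)).
  by rewrite /critical rmorphM /= dE rmorph_nat [e * _]mulrC.
have cJ : (crit u)^* = (t%:C * u^-1 - e) / (2 * (t%:C ^+ 2 - e^* * e)).
  rewrite cE rmorphM fmorphV !rmorphM !rmorphB rmorphXn rmorphM rmorphM /= !conjCK.
  by rewrite conj_realC conjC_nat uV [e * _]mulrC.
rewrite /extremal /center rmorphM rmorphB rmorph1 /= cmod_sqrC cJ cE.
rewrite !rmorphM rmorphD rmorph1 rmorphM /= dE rmorph_nat [e * _]mulrC.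
by field; apply/andP; split=> //; move: dC; rewrite mulrC.
Qed.

(** Adding the two strict maximality inequalities, for x at its critical point and
    for y at its own, leaves (y - x)(|z_x|^2 - |z_y|^2) > 0. *)
Lemma critical_lt u (x y : R) : cmod u = 1 -> cmod e < x -> x < y ->
  cmod (critical e u y) < cmod (critical e u x).
Proof.
move=> u1 ex xy; have ey : cmod e < y := lt_trans ex xy.
have sx := critical_stat u1 ex; have sy := critical_stat u1 ey.
have := support_gap (critical e u y) sx u1.
have := support_gap (critical e u x) sy u1; rewrite [cmod (critical e u x - _)]cmodBC.
have u0 : u != 0 by rewrite -cmod_gt0 u1.
have neq : critical e u y != critical e u x.
  apply/eqP => eq; move: sy; rewrite eq sx => /eqP.
  rewrite -subr_eq0 -mulrBl mulf_eq0 => /orP[|/eqP c0].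
    rewrite -mulrBr mulf_eq0 pnatr_eq0 /= -rmorphB /= -cmod_eq0 cmodR normr_eq0.
    by rewrite subr_eq0 (lt_eqF xy).
  by move: sx; rewrite c0 conjC0 !mulr0 subr0 mulr1 => /eqP; rewrite (negbTE u0).
have D0 : 0 < cmod (critical e u y - critical e u x) ^+ 2.
  by rewrite exprn_gt0 // cmod_gt0 subr_eq0.
set D := _ ^+ 2 in D0 *; set a := cmod (critical e u x); set b := cmod (critical e u y).
move=> h1 h2; rewrite -ltr_sqr ?nnegrE ?cmod_ge0 //.
have h3 : 0 < (x - cmod e) * D by rewrite mulr_gt0 // subr_gt0.
have h4 : 0 < (y - cmod e) * D by rewrite mulr_gt0 // subr_gt0.
have h5 : 0 < (y - x) * (a ^+ 2 - b ^+ 2) by rewrite mulrBl !mulrBr; lra.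
by move: h5; rewrite pmulr_rgt0 ?subr_gt0.
Qed.

Lemma critical_outer u x : cmod u = 1 -> t <= x -> cmod (critical e u x) = 1 ->
  outer (critical e u x).
Proof.
move=> u1 tx c1; split=> //; have ex : cmod e < x by exact: lt_le_trans tx.
have := congr1 (@cmod R) (critical_stat u1 ex).
have -> : 1 - 2 * e^* * (critical e u x)^* = (1 - 2 * e * critical e u x)^*.
  by rewrite rmorphB rmorph1 !rmorphM /= conjC_nat.
have x0 : 0 <= 2 * x by have := cmod_ge0 e; lra.
rewrite cmodM u1 mul1r cmodJ cmodM c1 mulr1 => ->.
have -> : 2 * x%:C = (2 * x)%:C :> C by rewrite rmorphM rmorph_nat.
by rewrite cmod_real //; lra.
Qed.

(** If z <> w have the same image then e (z + w) = 1, so 1 - 2 e z = e (w - z) has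
    modulus at most 2|e| < 2t. *)
Lemma outer_inj z w : outer z -> outer w -> center z = center w -> z = w.
Proof.
move=> [z1 zt] [w1 wt] /eqP; rewrite -subr_eq0.
have -> : center z - center w = (z - w) * (1 - e * (z + w)) by rewrite /center; ring.
rewrite mulf_eq0 subr_eq0 => /orP[/eqP //|]; rewrite subr_eq0 => /eqP E.
move: zt; have -> : 1 - 2 * e * z = e * (w - z).
  by transitivity (1 - e * (z + w) + e * (w - z)); [ring|rewrite -E subrr add0r].
rewrite cmodM => zt; have := cmodB w z; rewrite z1 w1 => h.
have : cmod e * cmod (w - z) <= cmod e * 2.
  by rewrite ler_wpM2l ?cmod_ge0 //; lra.
by move=> h2; exfalso; have := et; lra.
Qed.

End Frontier.

(** * Arcs of the unit circle *)

Section Arcs.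
Variable R : realType.
Local Notation C := (CC R).
Implicit Types (z w u : C) (k : R).

Lemma expi_surj u : cmod u = 1 -> exists2 x : R, - pi < x <= pi & u = expi x.
Proof. by move=> u1; have [x hx ->] := polar u; exists x; rewrite // u1 mul1r. Qed.

Lemma expiD2pi (x : R) : expi (x + 2 * pi) = expi x.
Proof.
rewrite /expi; have -> : 2 * pi = pi *+ 2 :> R by rewrite mulr_natl.
by rewrite cosD2pi sinD2pi.
Qed.

Lemma cos_le (x y : R) : 0 <= x <= pi -> 0 <= y <= pi -> (cos x <= cos y) = (y <= x).
Proof. by move=> hx hy; rewrite leNgt ltr_cos -?leNgt ?in_itv. Qed.

Lemma cos_lt (x y : R) : 0 <= x <= pi -> 0 <= y <= pi -> (cos x < cos y) = (y < x).
Proof. by move=> hx hy; rewrite ltr_cos ?in_itv. Qed.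

Lemma Re_expi (x : R) : complex.Re (expi x) = cos x.
Proof. by []. Qed.

Lemma acos_itv k : -1 < k < 1 -> 0 < acos k < pi /\ cos (acos k) = k.
Proof.
move=> /andP[k0 k1]; split; last by rewrite acosK // in_itv /= (ltW k0) (ltW k1).
by apply/andP; split; [apply: acos_gt0|apply: acos_ltpi]; rewrite ?k0 ?k1 ?(ltW k0) ?(ltW k1).
Qed.

Lemma closed_arc k : -1 < k < 1 -> [set u : C | cmod u = 1 /\ complex.Re u <= k] =
  [set expi x | x in [set x | x \in `[acos k, 2 * pi - acos k]]].
Proof.
move=> /acos_itv[]; set b := acos k => /andP[b0 bpi] <-.
apply/seteqP; split=> [u [u1]|_ [x /= + <-]].
  have [x /andP[x1 x2] ->] := expi_surj u1; rewrite Re_expi => hx.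
  have [x0|x0] := leP 0 x.
    exists x => //=; move: hx; rewrite cos_le ?in_itv /= ?x0 ?x2 ?(ltW b0) ?(ltW bpi) // => ->.
    by rewrite /=; lra.
  exists (x + 2 * pi); last exact: expiD2pi.
  move: hx; rewrite -cosN cos_le ?(ltW b0) ?(ltW bpi) //; last by apply/andP; split; lra.
  by rewrite /= in_itv /= => h; apply/andP; split; lra.
rewrite in_itv /= => /andP[x1 x2]; rewrite cmod_expi ?Re_expi; split=> //.
have [xpi|xpi] := leP x pi.
  by rewrite cos_le //; apply/andP; split; lra.
have -> : cos x = cos (2 * pi - x).
  have := expiD2pi (- x); rewrite /expi => -[+ _].
  by rewrite cosN addrC => ->.
by rewrite cos_le; try (apply/andP; split); lra.
Qed.

Lemma open_arc k : -1 < k < 1 -> [set u : C | cmod u = 1 /\ k < complex.Re u] =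
  [set expi x | x in [set x | x \in `]- acos k, acos k[]].
Proof.
move=> /acos_itv[]; set b := acos k => /andP[b0 bpi] <-.
have cosabs (x : R) : cos x = cos `|x|.
  by have [x0|x0] := leP 0 x; [rewrite ger0_norm|rewrite ltr0_norm ?cosN].
apply/seteqP; split=> [u [u1]|_ [x /= + <-]].
  have [x /andP[x1 x2] ->] := expi_surj u1; rewrite Re_expi (cosabs x) => hx.
  have h1 : 0 <= `|x| <= pi by rewrite normr_ge0 ler_norml (ltW x1).
  have h2 : 0 <= b <= pi by rewrite (ltW b0) (ltW bpi).
  by exists x => //=; rewrite in_itv /= -ltr_norml -(cos_lt h2 h1).
rewrite in_itv /= -ltr_norml => hx; rewrite cmod_expi ?Re_expi (cosabs x); split=> //.
have h1 : 0 <= `|x| <= pi by rewrite normr_ge0 ltW // (lt_trans hx).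
by rewrite (cos_lt _ h1) // (ltW b0) (ltW bpi).
Qed.

End Arcs.

(** * Circular and simple arcs of the boundary *)

Section Assembly.
Variable R : realType.
Local Notation C := (CC R).
Implicit Types (z w u : C).
Variables (r s : R) (lam : C).
Hypothesis (hs : 0 <= s) (hsr : s < r) (hr : r < 1) (hlam : cmod lam < 1).

Local Notation e := (eta r s lam).
Local Notation t := (tpar r s lam).
Local Notation m := (cmod (eta r s lam)).
Local Notation A := (coefA r s).
Local Notation B := (Defs.coefB r s lam).
Local Notation K := (Defs.coefC r s lam).
Local Notation dd := (4 * (t ^+ 2 - m ^+ 2)).

Lemma eta_lt_t : m < t.
Proof.
have t0 : 0 < t.
  rewrite (tparE lam hs hsr) cmod_gt0 mulf_neq0 ?(r_neq0 hs hsr) //.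
  by rewrite invr_eq0 (eta_den_neq0 hs hsr hlam).
have -> : m = t * cmod lam.
  rewrite (tparE lam hs hsr) etaE.
  have -> : r%:C * lam^* / eta_den r s lam = r%:C / eta_den r s lam * lam^* by ring.
  by rewrite cmodM cmodJ.
by rewrite gtr_pMr.
Qed.

Let t0 : 0 < t := le_lt_trans (cmod_ge0 _) eta_lt_t.
Let d0 : 0 < t ^+ 2 - m ^+ 2 := sqr_gap_gt0 eta_lt_t.

Lemma coefA_gt0 : 0 < A.
Proof.
have r_gt0 := r_gt0 hs hsr; have h1 := hs; have h2 := hsr; have h3 := hr.
rewrite /coefA divr_gt0 //.
  by rewrite mulr_gt0 // subr_gt0 ltr_sqr ?nnegrE // ltW.
rewrite mulr_gt0 ?exprn_gt0 // subr_gt0 -(expr1n _ 2) ltr_sqr ?nnegrE // ltW //.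
Qed.

Lemma coefAC_neq0 : A%:C * K != 0.
Proof.
rewrite mulf_neq0 //; first by rewrite -cmod_eq0 cmodR normr_eq0 gt_eqF // coefA_gt0.
rewrite coefC_complex !mulf_neq0 ?(r_neq0 hs hsr) ?(eta_den_neq0 hs hsr hlam) //.
rewrite -cmod_sqrC -(rmorph1 (real_complex R)) -rmorphB -cmod_eq0 cmodR normr_eq0.
by rewrite gt_eqF // subr_gt0 -(expr1n _ 2) ltr_sqr ?nnegrE ?cmod_ge0.
Qed.

Lemma frontier_Vset : frontier (Vset r s lam) = curve r s lam @` outer e t `|`
  [set circ r s lam u | u in [set u | cmod u = 1 /\ cmod (critical e u t) < 1]].
Proof.
rewrite (Vset_disk_union hs hsr hr hlam).
have -> : (fun w => A%:C * (B + K * w)) = (fun w => (A%:C * K) * w + A%:C * B).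
  by apply/funext => w; ring.
rewrite (frontier_affine _ _ coefAC_neq0) (frontier_disk_union eta_lt_t) image_setU.
congr (_ `|` _).
  rewrite image_comp; apply: eq_imagel => z _ /=.
  by rewrite /curve /cfun /center; ring.
rewrite image_comp; apply: eq_imagel => u [u1 _] /=.
by rewrite (extremal_circle eta_lt_t u1) /circ /=; ring.
Qed.

Definition kappa : C := A%:C * K * ((1 + dd) * t / dd)%:C.
Definition circ0 : C := A%:C * (B - e^* / dd%:C * K).

Lemma circE u : circ r s lam u = circ0 + kappa * u.
Proof. by rewrite /circ /kappa /circ0 /= !(rmorphM, fmorphV) /=; ring. Qed.

Lemma kappa_neq0 : kappa != 0.
Proof.
rewrite mulf_neq0 ?coefAC_neq0 // -cmod_eq0 cmodR normr_eq0 gt_eqF //.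
have h1 := d0; have h2 := t0.
have dd0 : 0 < dd by rewrite mulr_gt0.
by rewrite divr_gt0 // mulr_gt0 // addr_gt0.
Qed.

Lemma unit_circleE u : unit_circle u <-> cmod u = 1.
Proof.
rewrite /unit_circle /= -cmodE; split=> [h|->//].
by apply: complexI; rewrite h.
Qed.

Lemma curve_continuous : continuous (curve r s lam).
Proof.
move=> z; apply: regular_continuous; apply: (regularM (regular_cst _ _)).
apply: (regularD (regular_cst _ _)); apply: (regularM (regular_cst _ _)).
apply: regularM; first exact: regular_id.
apply: regularB; first exact: regular_cst.
exact: regularM (regular_cst _ _) (regular_id _).
Qed.

Lemma curve_simple : simple_param (outer e t) (curve r s lam).
Proof.
split; first exact: continuous_subspaceT curve_continuous.
move=> z w /set_mem Jz /set_mem Jw E; apply: (outer_inj eta_lt_t Jz Jw).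
have lin v : curve r s lam v = A%:C * K * center e v + A%:C * B.
  by rewrite /curve /cfun /center; ring.
by apply: (mulfI coefAC_neq0); apply: (addIr (A%:C * B)); rewrite -!lin.
Qed.

Lemma outer_full : t + m <= 1 / 2 -> outer e t = unit_circle /\
  [set u | cmod u = 1 /\ cmod (critical e u t) < 1] = set0.
Proof.
move=> h; have d1 := d0; have m0 := cmod_ge0 e; have mt := eta_lt_t; split.
  apply/seteqP; split=> [z [z1 _]|z /unit_circleE z1]; first exact/unit_circleE.
  split=> //; have : cmod (1 : C) <= cmod (1 - 2 * e * z) + cmod (2%:C * e * z).
    have -> : 2%:C = 2 :> C by rewrite rmorph_nat.
    by rewrite -{1}[1](subrK (2 * e * z)); exact: cmodD.
  by rewrite cmod1 [cmod (_ * z)]cmodM z1 mulr1 [cmod (2%:C * e)]cmodM cmod_real //; lra.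
apply/seteqP; split=> // u [u1]; have := critical_cmod u mt.
set c := cmod (critical _ _ _) => cE c1; exfalso.
have : cmod (t%:C * u) <= cmod (t%:C * u - e^*) + cmod (e^*).
  by rewrite -{1}[t%:C * u](subrK (e^*)); exact: cmodD.
rewrite cmodM u1 mulr1 cmodJ -cE cmod_real ?(ltW t0) // => h1.
have h2 : c * (2 * (t ^+ 2 - m ^+ 2)) < 1 * (2 * (t ^+ 2 - m ^+ 2)).
  by rewrite ltr_pM2r // mulr_gt0.
by nra.
Qed.

(** A multiplier above t would give a critical point of modulus less than 1, so
    every [outer] point has multiplier t and lies on the circle too. *)
Lemma boundary_circle : 1 / 2 <= t - m ->
  curve r s lam @` outer e t `|`
  [set circ r s lam u | u in [set u | cmod u = 1 /\ cmod (critical e u t) < 1]] =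
  circ r s lam @` unit_circle.
Proof.
move=> h; have d1 := d0; have m0 := cmod_ge0 e; have mt := eta_lt_t.
have curve_circ u : cmod u = 1 -> cmod (critical e u t) = 1 ->
    curve r s lam (critical e u t) = circ r s lam u.
  move=> u1 c1; have := extremal_circle mt u1; rewrite (extremal_unit _ _ u c1) => E.
  rewrite /curve /cfun; move: E; rewrite /center => ->.
  by rewrite /circ /=; ring.
apply/seteqP; split=> [p [[z Jz <-]|[u [u1 _] <-]]|_ [u /unit_circleE u1 <-]].
- have [u [x [u1 tx zE]]] := outer_critical mt Jz; have [z1 _] := Jz.
  have xt : x = t.
    apply/eqP; rewrite eq_le tx andbT leNgt; apply/negP => xt.
    have := critical_lt u1 mt xt; rewrite -zE z1; have := critical_cmod u mt.
    set c := cmod (critical _ _ _) => cE c1.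
    have := cmodB (t%:C * u) e^*; rewrite cmodM u1 mulr1 cmodJ cmod_real ?(ltW t0) // -cE.
    have h2 : 1 * (2 * (t ^+ 2 - m ^+ 2)) < c * (2 * (t ^+ 2 - m ^+ 2)).
      by rewrite ltr_pM2r // mulr_gt0.
    by nra.
  exists u; first exact/unit_circleE.
  by rewrite -curve_circ // -xt -zE.
- by exists u => //; exact/unit_circleE.
have c1 : cmod (critical e u t) <= 1.
  have dd2 : 0 < 2 * (t ^+ 2 - m ^+ 2) by rewrite mulr_gt0.
  rewrite -(ler_pM2r dd2) critical_cmod //; apply: (le_trans (cmodB _ _)).
  by rewrite cmodM u1 mulr1 cmodJ cmod_real ?(ltW t0) //; nra.
have [lt|ge] := ltP (cmod (critical e u t)) 1; first by right; exists u.
have {}c1 : cmod (critical e u t) = 1 by apply/eqP; rewrite eq_le c1.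
left; exists (critical e u t); last exact: curve_circ.
exact: critical_outer.
Qed.

Lemma circ_is_circle : is_circle (circ r s lam @` unit_circle).
Proof.
exists circ0, (cmod kappa); split; first by rewrite cmod_gt0 kappa_neq0.
apply/seteqP; split=> [_ [u /unit_circleE u1 <-]|p /=].
  by rewrite /= circE [circ0 + _]addrC addrK -cmodE cmodM u1 mulr1.
rewrite -cmodE => /complexI hp.
have k0 := kappa_neq0.
exists ((p - circ0) / kappa).
  by apply/unit_circleE; rewrite cmodM cmodV hp divff // cmod_eq0.
by rewrite circE; field.
Qed.

Section TwoArcs.
Hypotheses (h1 : 1 / 2 < t + m) (h2 : t - m < 1 / 2).
Local Notation phi := (Arg (eta r s lam)).

Lemma cmod_eta_gt0 : 0 < m.
Proof. by have := h1; have := h2; lra. Qed.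

Lemma eta_polar : e = m%:C * expi phi.
Proof. by have /Arg_bounds[] : e != 0 by rewrite -cmod_gt0 cmod_eta_gt0. Qed.

Lemma cosbound_itv : -1 < cosbound r s lam < 1.
Proof.
have m0 := cmod_eta_gt0; have mt := eta_lt_t.
have tm : 0 < 2 * t * m by rewrite mulr_gt0 // mulr_gt0.
have d1 := d0; have h3 := h1; have h4 := h2.
have a1 : 0 < t - m by lra.
have a2 : 0 < t + m by lra.
have dE : 4 * (t ^+ 2 - m ^+ 2) ^+ 2 = (t - m) ^+ 2 * (2 * (t + m)) ^+ 2 by ring.
have dE' : 4 * (t ^+ 2 - m ^+ 2) ^+ 2 = (t + m) ^+ 2 * (2 * (t - m)) ^+ 2 by ring.
rewrite /cosbound ltr_pdivrMr // ltr_pdivlMr // mul1r mulN1r; apply/andP; split.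
  suff : 4 * (t ^+ 2 - m ^+ 2) ^+ 2 < (t + m) ^+ 2 * 1.
    rewrite mulr1 => H; have E : (t + m) ^+ 2 = t ^+ 2 + m ^+ 2 + 2 * t * m by ring.
    by move: H; rewrite E; lra.
  rewrite dE' ltr_pM2l ?exprn_gt0 // -(expr1n _ 2) ltr_sqr ?nnegrE //; lra.
suff : (t - m) ^+ 2 * 1 < 4 * (t ^+ 2 - m ^+ 2) ^+ 2.
  rewrite mulr1 => H; have E : (t - m) ^+ 2 = t ^+ 2 + m ^+ 2 - 2 * t * m by ring.
  by move: H; rewrite E; lra.
rewrite dE ltr_pM2l ?exprn_gt0 // -(expr1n _ 2) ltr_sqr ?nnegrE //; lra.
Qed.

(** Expanding |t u - eta^*|^2 by the law of cosines. *)
Lemma critical_lt1 u : cmod u = 1 ->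
  (cmod (critical e u t) < 1) = (cosbound r s lam < complex.Re (u * expi phi)).
Proof.
move=> u1; have m0 := cmod_eta_gt0; have tm : 0 < 2 * t * m by rewrite mulr_gt0 // mulr_gt0.
have dd2 : 0 < 2 * (t ^+ 2 - m ^+ 2) by rewrite mulr_gt0.
rewrite -(ltr_pM2r dd2) (critical_cmod u eta_lt_t) mul1r.
rewrite -ltr_sqr ?nnegrE ?cmod_ge0 ?(ltW dd2) // /cosbound ltr_pdivrMr //.
have -> : cmod (t%:C * u - e^*) ^+ 2 =
    t ^+ 2 + m ^+ 2 - complex.Re (u * expi phi) * (2 * t * m).
  rewrite cmodDsqr dotNr dotZl cmodN cmodJ cmodM u1 mulr1 (cmod_real (ltW t0)).
  have -> : dot u (e^*) = m * complex.Re (u * expi phi).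
    rewrite {1}eta_polar /dot rmorphM /= conj_realC mulrCA -rmorphM /= conjE.
    by case: (u * expi phi) => a b; simpc.
  by ring.
have -> : (2 * (t ^+ 2 - m ^+ 2)) ^+ 2 = 4 * (t ^+ 2 - m ^+ 2) ^+ 2 by ring.
by rewrite ltrBlDr [X in _ < X]addrC -ltrBlDr.
Qed.

Lemma critical_lt1_expi (x : R) :
  (cmod (critical e (expi x) t) < 1) = (cosbound r s lam < cos (x + phi)).
Proof. by rewrite critical_lt1 ?cmod_expi // -expiD. Qed.

Lemma Theta_circ : [set circ r s lam (expi x) | x in Theta r s lam] =
  [set circ r s lam u | u in [set u | cmod u = 1 /\ cmod (critical e u t) < 1]].
Proof.
apply/seteqP; split=> [_ [x [xI hx] <-]|_ [u [u1 hu] <-]].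
  by exists (expi x) => //=; rewrite cmod_expi critical_lt1_expi.
have [x hx uE] := expi_surj u1; exists x; last by rewrite uE.
by split; [rewrite in_itv|rewrite -critical_lt1_expi -uE].
Qed.

Lemma Theta_circ_arc : is_circular_arc [set circ r s lam (expi x) | x in Theta r s lam].
Proof.
have [/andP[b0 bpi] _] := acos_itv cosbound_itv; set b := acos _ in b0 bpi.
have k0 := kappa_neq0; have [_ kE] := Arg_bounds k0; set psi := Arg kappa in kE.
exists circ0, (cmod kappa), (psi - phi - b), (psi - phi + b).
split; [by rewrite cmod_gt0|by apply/andP; split; lra|].
rewrite Theta_circ; have := open_arc cosbound_itv; rewrite -/b => E.
have ks u : circ r s lam u = circ0 + (cmod kappa)%:C * (expi psi * u).
  by rewrite circE {1}kE mulrA.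
apply/seteqP; split=> [_ [u [u1 hu] <-]|_ [x /= hx <-]].
  have : [set u : C | cmod u = 1 /\ cosbound r s lam < complex.Re u] (u * expi phi).
    by split; [rewrite cmodM u1 cmod_expi mulr1|rewrite -critical_lt1].
  rewrite E => -[x /=]; rewrite in_itv /= => /andP[x1 x2] xE.
  exists (psi - phi + x); first by rewrite /= in_itv /=; apply/andP; split; lra.
  rewrite ks; congr (_ + _ * _).
  have -> : psi - phi + x = (psi + x) - phi by ring.
  by rewrite !expiD xE -!mulrA -expiD subrr /expi cos0 sin0 -[1 +i* 0]/(1 : C) mulr1.
move: hx; rewrite in_itv /= => /andP[x1 x2].
have : [set expi x | x in [set x | x \in `]- b, b[]] (expi (x - psi + phi)).
  by exists (x - psi + phi) => //=; rewrite in_itv /=; apply/andP; split; lra.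
rewrite -E => -[_ hx]; exists (expi (x - psi)).
  by rewrite /= cmod_expi critical_lt1 ?cmod_expi // -expiD.
by rewrite ks -expiD; congr (_ + _ * expi _); ring.
Qed.

(** The critical point of multiplier t_theta has speed |1 - 2 eta z| = 2 t_theta, and
    the monotonicity of its modulus in the multiplier makes t_theta unique and at
    least [t] in the directions considered. *)
Lemma JsetE : Jset r s lam = outer e t.
Proof.
have mt := eta_lt_t.
have tth x : cos (x + phi) <= cosbound r s lam -> [/\ t <= ttheta r s lam x,
   cmod (critical e (expi x) (ttheta r s lam x)) = 1 &
   zetatheta r s lam x = critical e (expi x) (ttheta r s lam x)].
  rewrite leNgt -critical_lt1_expi -leNgt => c1; have u1 := cmod_expi x.
  have [y ty cy] := critical_on_circle mt u1 c1.
  have circ1 v : m < v -> cmod (v%:C * expi x - e^*) = 2 * (v ^+ 2 - m ^+ 2) ->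
      cmod (critical e (expi x) v) = 1.
    move=> mv hv; have dv : 0 < 2 * (v ^+ 2 - m ^+ 2) by rewrite mulr_gt0 // sqr_gap_gt0.
    by apply: (mulIf (lt0r_neq0 dv)); rewrite critical_cmod // mul1r.
  rewrite /zetatheta /ttheta -critical_cmod // ler_peMl //; last by rewrite mulr_ge0 // ltW.
  case: xgetP => [v -> [mv /(circ1 _ mv) cv]|/(_ y)]; last first.
    case; split; first exact: lt_le_trans ty.
    by rewrite -critical_cmod ?cy ?mul1r //; exact: lt_le_trans ty.
  split=> //; rewrite leNgt; apply/negP => vt.
  by have := critical_lt u1 mv vt; rewrite cv ltNge c1.
apply/seteqP; split=> [_ [x [_ /tth[tx cx ->]] <-]|z Jz].
  exact: (critical_outer mt (cmod_expi x) tx cx).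
have [u [y [u1 ty zE]]] := outer_critical mt Jz; have [z1 _] := Jz.
have [x hx uE] := expi_surj u1; have my : m < y := lt_le_trans mt ty.
have hc : cos (x + phi) <= cosbound r s lam.
  rewrite leNgt -critical_lt1_expi -leNgt -uE -z1 zE.
  by move: ty; rewrite le_eqVlt => /orP[/eqP -> //|ty]; rewrite ltW // critical_lt.
have [tv cv vE] := tth _ hc; exists x; first by split; [rewrite in_itv|].
rewrite vE zE uE; congr (critical e _ _); set v := ttheta r s lam x in tv cv *.
have mv : m < v := lt_le_trans mt tv.
rewrite zE uE in z1.
case: (ltgtP v y) => // vy.
  by have := critical_lt (cmod_expi x) mv vy; rewrite z1 cv ltxx.
by have := critical_lt (cmod_expi x) my vy; rewrite z1 cv ltxx.
Qed.

(** On the unit circle |1 - 2 eta z|^2 = 1 + 4 m^2 - 4 m Re (z e^(i arg eta)), so the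
    condition of [outer] bounds a cosine. *)
Lemma Jset_subarc : is_closed_subarc (Jset r s lam).
Proof.
have m0 := cmod_eta_gt0; have mt := eta_lt_t; have h3 := h1; have h4 := h2.
pose k := (1 + 4 * m ^+ 2 - 4 * t ^+ 2) / (4 * m).
have m4 : 0 < 4 * m by rewrite mulr_gt0.
have k1 : -1 < k < 1.
  rewrite /k ltr_pdivrMr // ltr_pdivlMr // mul1r mulN1r; apply/andP; split.
    have : 0 < (1 + 2 * m - 2 * t) * (1 + 2 * m + 2 * t) by rewrite mulr_gt0 //; lra.
    by lra.
  have : 0 < (2 * t + 2 * m - 1) * (2 * t - 2 * m + 1) by rewrite mulr_gt0 //; lra.
  by lra.
have [/andP[b0 bpi] _] := acos_itv k1; have E := closed_arc k1.
rewrite JsetE; set b := acos k in b0 bpi E.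
exists (b - phi), (2 * pi - b - phi); split; first by apply/andP; split; lra.
have outE z : cmod z = 1 -> (2 * t <= cmod (1 - 2 * e * z)) = (complex.Re (z * expi phi) <= k).
  move=> z1; have t2 : 0 <= 2 * t by rewrite mulr_ge0 // ltW.
  rewrite -ler_sqr ?nnegrE ?cmod_ge0 //.
  have -> : cmod (1 - 2 * e * z) ^+ 2 =
      1 + 4 * m ^+ 2 - complex.Re (z * expi phi) * (4 * m).
    have -> : 2 * e * z = (2 * m)%:C * (z * expi phi).
      by rewrite {1}eta_polar rmorphM rmorph_nat; ring.
    rewrite cmodDsqr dotNr dotZr cmodN [cmod (_ * (_ * _))]cmodM [cmod (z * _)]cmodM.
    rewrite z1 cmod_expi cmod1 cmod_real ?mulr_ge0 // ?ltW //.
    have -> : dot 1 (z * expi phi) = complex.Re (z * expi phi).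
      by rewrite /dot conjC1 mul1r.
    by ring.
  rewrite /k ler_pdivlMr //; have -> : (2 * t) ^+ 2 = 4 * t ^+ 2 by ring.
  by rewrite lerBrDr addrC -lerBrDr.
have expiV (x : R) : expi (x - phi) * expi phi = expi x :> C by rewrite -expiD subrK.
apply/seteqP; split=> [z [z1 zt]|_ [x /= hx <-]].
  have : [set u : C | cmod u = 1 /\ complex.Re u <= k] (z * expi phi).
    by split; [rewrite cmodM z1 cmod_expi mulr1|rewrite -outE].
  rewrite E => -[x /=]; rewrite in_itv /= => /andP[x1 x2] xE.
  exists (x - phi); first by rewrite /= in_itv /=; apply/andP; split; lra.
  have nz : expi phi != 0 :> C by rewrite -cmod_gt0 cmod_expi.
  by apply: (mulIf nz); rewrite expiV.
move: hx; rewrite in_itv /= => /andP[x1 x2].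
have : [set expi x | x in [set x | x \in `[b, 2 * pi - b]]] (expi (x + phi)).
  by exists (x + phi) => //=; rewrite in_itv /=; apply/andP; split; lra.
rewrite -E => -[_ hx]; split; first exact: cmod_expi.
by rewrite outE ?cmod_expi // -expiD.
Qed.

End TwoArcs.

End Assembly.

Theorem theorem4p2 (R : realType) (r s : R) (lam : CC R)
    (hs : 0 <= s) (hsr : s < r) (hr : r < 1) (hlam : `|lam| < 1) :
  let t := tpar r s lam in
  let m := cmod (eta r s lam) in
  [/\ t + m <= 1 / 2 ->
        simple_param unit_circle (curve r s lam) /\
        frontier (Vset r s lam) = curve r s lam @` unit_circle,
      1 / 2 <= t - m ->
        is_circle (circ r s lam @` unit_circle) /\
        frontier (Vset r s lam) = circ r s lam @` unit_circle
    & 1 / 2 < t + m -> t - m < 1 / 2 ->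
        let arc := [set circ r s lam (expi theta) | theta in Theta r s lam] in
        [/\ is_circular_arc arc,
            is_closed_subarc (Jset r s lam),
            simple_param (Jset r s lam) (curve r s lam)
          & frontier (Vset r s lam) = arc `|` curve r s lam @` Jset r s lam]].
Proof.
have lam1 : cmod lam < 1 by exact/unit_diskE.
have FV := frontier_Vset hs hsr hr lam1.
have CS := curve_simple hs hsr hr lam1.
move=> t m; split=> [h|h|h1 h2].
- have [oE cE] := outer_full hs hsr lam1 h.
  by rewrite FV -oE cE image_set0 setU0.
- rewrite FV (boundary_circle hs hsr lam1 h).
  by split=> //; exact: circ_is_circle.
have JE := JsetE hs hsr lam1 h1 h2.
move=> arc; split.
- exact: Theta_circ_arc.
- exact: Jset_subarc.
- by rewrite JE.
- by rewrite FV JE setUC /arc Theta_circ.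
Qed.
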